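(* Let $\Lambda$ be an Artin algebra such that $\mathcal{P}^\infty(\Lambda\text{-mod})$ is contravariantly finite in $\Lambda\text{-mod}$, and let $C_1,\dots,C_n$ be arbitrary $\mathcal{P}^\infty(\Lambda\text{-mod})$-approximations of the simple left $\Lambda$-modules (one for each isomorphism class of simple modules). Then $$\mathrm{Fin.dim}\,\Lambda=\sup\{\operatorname{p\,dim} C_i \mid 1\le i\le n\}.$$
   Context: $\Lambda\text{-Mod}$ is the category of all left $\Lambda$-modules and $\Lambda\text{-mod}$ the category of finitely generated left $\Lambda$-modules. $\mathcal{P}^\infty(\Lambda\text{-mod})$ is the full subcategory of $\Lambda\text{-mod}$ consisting of the modules of finite projective dimension. $\operatorname{p\,dim}$ denotes projective dimension. The left big finitistic dimension $\mathrm{Fin.dim}\,\Lambda$ is the supremum of the projective dimensions of all (not necessarily finitely generated) left $\Lambda$-modules of finite projective dimension. For a full subcategory $\mathcal{A}$ of $\Lambda\text{-mod}$ and $M\in\Lambda\text{-mod}$, an $\mathcal{A}$-approximation of $M$ is an object $A\in\mathcal{A}$ together with a homomorphism $f:A\to M$ such that every homomorphism $B\to M$ with $B\in\mathcal{A}$ factors through $f$. $\mathcal{A}$ is contravariantly finite in $\Lambda\text{-mod}$ if every $M\in\Lambda\text{-mod}$ has an $\mathcal{A}$-approximation. *)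

(* Defs.v *)
From HB Require Import structures.
From mathcomp Require Import all_boot all_order all_algebra.
From mathcomp Require Import boolp classical_sets.

Set Implicit Arguments.
Unset Strict Implicit.
Unset Printing Implicit Defensive.

Import Order.TTheory GRing.Theory.

Local Open Scope ring_scope.
Local Open Scope classical_set_scope.

(* The extended natural numbers; None is the value infinity. *)
Definition enat : Type := option nat.
Definition enat_fin (n : nat) : enat := Some n.
Definition enat_infty : enat := None.

Definition enat_le (a b : enat) : bool :=
  match a, b with
  | _, None => true
  | None, Some _ => false
  | Some m, Some n => (m <= n)%N
  end.

Fact enat_le_refl : reflexive enat_le.
Proof. by case=> //= n; exact: leqnn. Qed.

Fact enat_le_anti : antisymmetric enat_le.
Proof. by case=> [m|] [n|] //= /anti_leq ->. Qed.

Fact enat_le_trans : transitive enat_le.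
Proof. by case=> [m|] [n|] [p|] //=; exact: leq_trans. Qed.

Fact enat_le_total : total enat_le.
Proof. by case=> [m|] [n|] //=; exact: leq_total. Qed.

Fact enat_display : Order.disp_t. Proof. by []. Qed.

HB.instance Definition _ := Choice.on enat.
HB.instance Definition _ := Order.Le_isPOrder.Build enat_display enat
  enat_le_refl enat_le_anti enat_le_trans.
HB.instance Definition _ :=
  Order.POrder_isTotal.Build enat_display enat enat_le_total.

(* The supremum in N u {infinity}; that of the empty set is 0. *)
Definition enat_sup (A : set enat) : enat := supremum (enat_fin 0) A.
Definition enat_inf (A : set enat) : enat := infimum enat_infty A.

Section Modules.
Variable L : pzRingType.
Implicit Types M N P : lmodType L.

Definition fin_gen M : Prop :=
  exists (n : nat) (s : 'I_n -> M),
    forall x : M, exists c : 'I_n -> L, x = \sum_(i < n) c i *: s i.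

Definition lmod_isom M N : Prop := exists f : {linear M -> N}, bijective f.

Definition simple_lmod M : Prop :=
  (exists x : M, x != 0) /\
  forall S : {pred M}, GRing.submod_closed S -> S =i pred1 0 \/ S =i predT.

Definition projective P : Prop :=
  forall (M N : lmodType L) (p : {linear M -> N}) (g : {linear P -> N}),
    (forall y : N, exists x : M, p x = y) ->
    exists h : {linear P -> M}, forall x : P, p (h x) = g x.

(* ... -> P 2 -> P 1 -> P 0 -> M -> 0 is exact with every P i projective. *)
Definition proj_resolution M (P : nat -> lmodType L)
    (d : forall i, {linear P i.+1 -> P i}) (e : {linear P 0%N -> M}) : Prop :=
  [/\ forall i, projective (P i),
      forall y : M, exists x : P 0%N, e x = y,
      forall x : P 0%N, e x = 0 <-> exists z : P 1%N, d 0%N z = x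
    & forall i (x : P i.+1),
        d i x = 0 <-> exists z : P i.+2, d i.+1 z = x].

(* Resolutions of length at most n: the terms in degrees above n vanish. *)
Definition has_proj_resolution M (n : nat) : Prop :=
  exists (P : nat -> lmodType L) (d : forall i, {linear P i.+1 -> P i})
         (e : {linear P 0%N -> M}),
    proj_resolution d e /\ forall i, (n < i)%N -> forall x : P i, x = 0.

(* With this convention the zero module has projective dimension 0. *)
Definition pdim M : enat :=
  enat_inf [set enat_fin n | n in [set n | has_proj_resolution M n]].

Definition Pinf M : Prop := fin_gen M /\ (pdim M < enat_infty)%O.

Definition Findim : enat :=
  enat_sup [set v | exists M, (pdim M < enat_infty)%O /\ v = pdim M].

(* Full subcategories of finitely generated modules are given by the predicate
   singling out their objects. *)
Definition approximation (A : lmodType L -> Prop) M (C : lmodType L)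
    (f : {linear C -> M}) : Prop :=
  A C /\ forall (B : lmodType L) (g : {linear B -> M}), A B ->
    exists h : {linear B -> C}, forall x : B, g x = f (h x).

Definition contravariantly_finite (A : lmodType L -> Prop) : Prop :=
  forall M, fin_gen M ->
    exists (C : lmodType L) (f : {linear C -> M}), approximation A f.

Definition simple_representatives (n : nat) (S : 'I_n -> lmodType L) : Prop :=
  [/\ forall i, simple_lmod (S i),
      forall i j, lmod_isom (S i) (S j) -> i = j
    & forall M, simple_lmod M -> exists i, lmod_isom M (S i)].

End Modules.

(* Descending chain condition on ideals, i.e. on submodules of k over itself. *)
Definition artinian (k : comPzRingType) : Prop :=
  forall I : nat -> {pred k^o},
    (forall n, GRing.submod_closed (I n)) ->
    (forall n, {subset I n.+1 <= I n}) ->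
    exists m, forall n, (m <= n)%N -> I n =i I m.

(* L is an algebra over a commutative artinian ring k through a ring morphism
   phi from k to the center of L, and is a finitely generated k-module. *)
Definition artin_algebra (L : pzRingType) : Prop :=
  exists (k : comPzRingType) (phi : {rmorphism k -> L}),
    [/\ artinian k,
        forall (a : k) (x : L), phi a * x = x * phi a
      & exists (n : nat) (s : 'I_n -> L), forall x : L,
          exists c : 'I_n -> k, x = \sum_(i < n) phi (c i) * s i].

(* The library's supremum and infimum are total functions; these facts check
   that the values above are the genuine ones. *)
Lemma enat_inf_lbound (A : set enat) :
  lbound A (enat_inf A) /\ forall b, lbound A b -> (b <= enat_inf A)%O.
Proof.
rewrite /enat_inf /infimum; case: eqP => [->|/eqP A0].
  by split=> // b _; case: b.
suff [m Am] : exists m, infimums A m by case: (xgetPex enat_infty (ex_intro _ m Am)).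
have [[n An]|nA] := pselect (exists n, A (enat_fin n)).
  have ex : exists n, `[< A (enat_fin n) >] by exists n; apply/asboolP.
  case: (ex_minnP ex) => m /asboolP Am min_m; exists (enat_fin m); split.
    by case=> [p Ap|//]; apply: min_m; apply/asboolP.
  by move=> b; apply.
exists enat_infty; split; last by move=> b _; case: b.
by case=> [p Ap|//]; case: nA; exists p.
Qed.

Lemma enat_sup_isLub (A : set enat) : isLub A (enat_sup A).
Proof.
rewrite /enat_sup /supremum; case: eqP => [->|/eqP A0].
  by split=> // b _; case: b.
suff [m Am] : exists m, supremums A m by case: (xgetPex (enat_fin 0) (ex_intro _ m Am)).
have [ub lb] := enat_inf_lbound (ubound A).
exists (enat_inf (ubound A)); split => //.
by move=> x Ax; apply: lb => y; apply.
Qed.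

Lemma pdim_leP (L : pzRingType) (M : lmodType L) (n : nat) :
  (pdim M <= enat_fin n)%O <-> has_proj_resolution M n.
Proof.
have [lbM maxM] := enat_inf_lbound
  [set enat_fin n | n in [set n | has_proj_resolution M n]].
split=> [le_n|resM]; last by apply: lbM; exists n.
apply: contrapT => no_res.
have /maxM : lbound [set enat_fin n | n in [set n | has_proj_resolution M n]]
    (enat_fin n.+1).
  move=> _ [m [P [d [e [res triv]]]] <-]; change (n < m)%N.
  rewrite ltnNge; apply/negP => le_mn; apply: no_res; exists P, d, e.
  by split=> // i /(leq_ltn_trans le_mn); exact: triv.
rewrite -/(pdim M) => /le_trans /(_ le_n).
by change ((n.+1 <= n)%N -> False); rewrite ltnn.
Qed.

(* Main.v *)
Require Import Defs.
From HB Require Import structures.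
From mathcomp Require Import all_boot all_order all_algebra.
From mathcomp Require Import boolp classical_sets.

(* Let d bound the projective dimensions of the approximations C_i.  A summand
   of C_i on which the approximation is right minimal has, by Wakamatsu's
   lemma, a kernel K_i with Ext^1(A, K_i) = 0 for all finitely generated A of
   finite projective dimension.  Since the radical is nilpotent, gluing direct
   sums of these sequences along a semisimple filtration yields, for every
   module X, an exact sequence 0 -> K -> A -> X -> 0 with pdim A <= d, with A a
   directed union of finitely generated submodules of finite projective
   dimension, and with K an iterated extension of direct sums of the K_i.

   Call Z "factoring" if every map from a finitely generated module to Z
   factors through a finitely generated module of finite projective dimension.
   Direct sums of the K_i have the descending chain condition on matrix
   subgroups, hence are pure-injective, so that Ext^1(Z, K) = 0 for factoring Z
   and K as above.  By induction on pdim X, every X of finite projective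
   dimension is factoring: the first syzygy of X is factoring, which forces the
   approximation 0 -> K2 -> A1 -> K1 -> 0 of the kernel of 0 -> K1 -> A0 -> X -> 0
   to split; then 0 -> A1 -> A0 + K2 -> X -> 0 is exact and exhibits X as
   factoring.  Consequently 0 -> K1 -> A0 -> X -> 0 splits and pdim X <= d. *)

Set Implicit Arguments.
Unset Strict Implicit.
Unset Printing Implicit Defensive.

Import GRing.Theory.
Local Open Scope ring_scope.

(** * Linear maps, submodules, quotients and direct sums *)

Section LinearMaps.
Variable L : pzRingType.
Implicit Types M N Q U : lmodType L.

(** The obstacle is that X is arbitrary: minimality is exploited over the simple modules only, and
    the rest must follow from vanishing of Ext^1(Z, K) for large Z. Gluing a layer with
    approximation A on top of a kernel K is obstructed by Ext^2(A, K), which is Ext^1 of a syzygy of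
    A; that syzygy is taken as a direct sum of finitely generated modules of finite projective
    dimension, so Ext^1 suffices throughout. For factoring Z, the vanishing known for finitely
    generated modules lifts every map from a finitely generated module to Z along an extension of Z
    by K. Such an extension is pure, and pure-injectivity splits it. Only direct sums of the K_i
    have to be pure-injective, since vanishing passes to extensions in the second variable. Their
    chain condition comes from the center: a matrix subgroup of a direct sum is determined by those
    of the finitely many K_i, which are k-submodules of modules of finite length over k. The bound d
    survives because A is built from summands of the C_i by direct sums and extensions alone. *)

Definition mklin M N (f : M -> N) (fl : linear f) : {linear M -> N} :=
  HB.pack f (GRing.isLinear.Build L M N *:%R f fl).

Definition submod M (U : M -> Prop) : Prop :=
  U 0 /\ forall a x y, U x -> U y -> U (a *: x + y).

Section Transport.
Variables (T : Type) (zero : T) (opp : T -> T) (add : T -> T -> T)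
  (scale : L -> T -> T).
Hypothesis addA : associative add.
Hypothesis addC : commutative add.
Hypothesis add0 : left_id zero add.
Hypothesis addN : left_inverse zero opp add.
Hypothesis scA : forall a b v, scale a (scale b v) = scale (a * b) v.
Hypothesis sc1 : left_id 1 scale.
Hypothesis scDr : right_distributive scale add.
Hypothesis scDl : forall v, {morph scale^~ v : a b / a + b >-> add a b}.

Let C : choiceType := HB.pack_for choiceType T (gen_eqMixin T) (gen_choiceMixin T).
Let Z : zmodType := HB.pack_for zmodType T C
  (GRing.isZmodule.Build C addA addC add0 addN).

(** Equality and choice on the carrier come from classical logic, so subtypes of Prop-valued
    predicates and sets of cosets can both carry a module structure. *)
Definition lmod_pack : lmodType L :=
  HB.pack_for (lmodType L) T Z
    (GRing.Zmodule_isLmodule.Build L Z scA sc1 scDr scDl).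
End Transport.

Lemma exists_sub M (U : M -> Prop) : submod U ->
  exists (S : lmodType L) (i : {linear S -> M}),
    injective i /\ forall x, U x <-> exists s, i s = x.
Proof.
move=> [U0 Ul].
have UZ a x : U x -> U (a *: x) by move=> Ux; rewrite -[_ *: _]addr0; exact: Ul.
have UD x y : U x -> U y -> U (x + y).
  by move=> Ux Uy; rewrite -[x]scale1r; exact: Ul.
have UN x : U x -> U (- x) by move=> Ux; rewrite -scaleN1r; exact: UZ.
pose T := {x : M | U x}.
have val_inj : injective (@sval M U) by move=> [x Ux] [y Uy] /= xy; exact: eq_exist.
pose add (x y : T) : T := exist U _ (UD _ _ (svalP x) (svalP y)).
pose opp (x : T) : T := exist U _ (UN _ (svalP x)).
pose sc a (x : T) : T := exist U _ (UZ a _ (svalP x)).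
unshelve eexists (@lmod_pack T (exist U 0 U0) opp add sc _ _ _ _ _ _ _ _).
- by move=> x y z; apply: val_inj; rewrite /= addrA.
- by move=> x y; apply: val_inj; rewrite /= addrC.
- by move=> x; apply: val_inj; rewrite /= add0r.
- by move=> x; apply: val_inj; rewrite /= addNr.
- by move=> a b x; apply: val_inj; rewrite /= scalerA.
- by move=> x; apply: val_inj; rewrite /= scale1r.
- by move=> a x y; apply: val_inj; rewrite /= scalerDr.
- by move=> x a b; apply: val_inj; rewrite /= scalerDl.
match goal with |- exists i : {linear ?S -> _}, _ =>
  unshelve eexists (@mklin S M (fun x : T => sval x) _); first by [] end.
split; first exact: val_inj.
by move=> x; split=> [Ux|[[y Uy] /= <- //]]; exists (exist U x Ux).
Qed.

Lemma exists_quo M (U : M -> Prop) : submod U ->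
  exists (Q : lmodType L) (p : {linear M -> Q}),
    (forall y, exists x, p x = y) /\ forall x, p x = 0 <-> U x.
Proof.
move=> [U0 Ul].
have UD x y : U x -> U y -> U (x + y).
  by move=> Ux Uy; rewrite -[x]scale1r; exact: Ul.
have UN x : U x -> U (- x).
  by move=> Ux; rewrite -scaleN1r -[_ *: _]addr0; exact: Ul.
pose coset (x : M) : set M := fun y => U (y - x).
have cosetP x y : coset x = coset y <-> U (x - y).
  split=> [E|Uxy]; first by have : coset x x by [rewrite /coset subrr]; rewrite E.
  apply/funext => z; apply/propext; rewrite /coset; split=> [Uz|Uz].
    by rewrite -[z](subrK x) -addrA; exact: UD.
  by rewrite -[z](subrK y) -addrA; apply: UD => //; rewrite -opprB; exact: UN.
pose T := {A : set M | exists x, A = coset x}.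
pose q (x : M) : T := exist _ (coset x) (ex_intro _ x erefl).
have qP x y : q x = q y <-> U (x - y).
  rewrite -cosetP; split=> [/(congr1 (@sval _ _)) //|xy].
  exact: eq_exist.
have /choice [r rK] : forall t : T, exists x, q x = t.
  by case=> A [x xA]; exists x; exact: eq_exist.
have qr x : U (x - r (q x)) by apply/qP; rewrite rK.
(* The operations are computed on chosen representatives; compatibility with [q] ([qD], [qN], [qZ])
   then transfers every module law from [M]. *)
pose add x y := q (r x + r y); pose opp x := q (- r x).
pose sc a x := q (a *: r x).
have qD x y : add (q x) (q y) = q (x + y).
  by apply/esym/qP; rewrite opprD addrACA; exact: UD.
have qN x : opp (q x) = q (- x).
  by apply/qP; rewrite opprK addrC.
have qZ a x : sc a (q x) = q (a *: x).
  by apply/esym/qP; rewrite -scalerBr -[_ *: _]addr0; exact: Ul.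
have qs (P : T -> Prop) : (forall x, P (q x)) -> forall t, P t.
  by move=> H t; rewrite -[t]rK.
unshelve eexists (@lmod_pack T (q 0) opp add sc _ _ _ _ _ _ _ _).
- by move=> x y z; elim/qs: x => x; elim/qs: y => y; elim/qs: z => z; rewrite !qD addrA.
- by move=> x y; elim/qs: x => x; elim/qs: y => y; rewrite !qD addrC.
- by move=> x; elim/qs: x => x; rewrite !qD add0r.
- by move=> x; elim/qs: x => x; rewrite qN qD addNr.
- by move=> a b x; elim/qs: x => x; rewrite !qZ scalerA.
- by move=> x; elim/qs: x => x; rewrite qZ scale1r.
- by move=> a x y; elim/qs: x => x; elim/qs: y => y; rewrite qD !qZ qD scalerDr.
- by move=> x; elim/qs: x => x a b; rewrite !qZ qD scalerDl.
match goal with |- exists i : {linear _ -> ?Q}, _ =>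
  unshelve eexists (@mklin M Q (fun x : M => q x) _) end.
  move=> a x y; change (q (a *: x + y) = add (sc a (q x)) (q y)).
  by rewrite qZ qD.
split; first by move=> y; exists (r y); exact: rK.
by move=> x; change (q x = q 0 <-> U x); rewrite qP subr0.
Qed.

(** Two values at the same point differ by a value at 0, so triviality at 0 makes the relation a
    function, and linearity is inherited. Maps defined through arbitrary preimages are obtained this
    way. *)
Lemma lin_of_rel M N (R : M -> N -> Prop) :
    (forall a x x' y y', R x y -> R x' y' -> R (a *: x + x') (a *: y + y')) ->
    (forall x, exists y, R x y) -> (forall y, R 0 y -> y = 0) ->
  exists f : {linear M -> N}, forall x, R x (f x).
Proof.
move=> Rl /choice [f Rf] R0.
have Ru x y y' : R x y -> R x y' -> y = y'.
  move=> Ry Ry'; apply/eqP; rewrite -subr_eq0; apply/eqP/R0.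
  by have := Rl (-1) _ _ _ _ Ry' Ry; rewrite !scaleN1r addNr addrC.
unshelve eexists (@mklin _ _ f _) => //.
by move=> a x y; apply: Ru (Rf _) _; exact: Rl.
Qed.

Lemma factor_surj M N Q (p : {linear M -> Q}) (f : {linear M -> N}) :
    (forall y, exists x, p x = y) -> (forall x, p x = 0 -> f x = 0) ->
  exists g : {linear Q -> N}, forall x, g (p x) = f x.
Proof.
move=> ps pf.
have [g gP] : exists g : {linear Q -> N},
    forall y, exists x, p x = y /\ f x = g y.
  apply: (lin_of_rel (R := fun y z => exists x, p x = y /\ f x = z)).
  - move=> a _ _ _ _ [x [<- <-]] [y [<- <-]]; exists (a *: x + y).
    by rewrite !linearP.
  - by move=> y; have [x <-] := ps y; exists (f x), x.
  - by move=> z [x [/pf <-]].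
exists g => x; have [x' [px' <-]] := gP (p x).
by apply/eqP; rewrite -subr_eq0 -linearB pf // linearB /= px' subrr.
Qed.

Lemma factor_inj U M N (i : {linear U -> M}) (f : {linear N -> M}) :
    injective i -> (forall x, exists u, i u = f x) ->
  exists g : {linear N -> U}, forall x, i (g x) = f x.
Proof.
move=> ii fi; apply: (lin_of_rel (R := fun x u => i u = f x)) => //.
- by move=> a x x' y y' E E'; rewrite !linearP E E'.
- by move=> u; rewrite linear0 -[RHS](linear0 i) => /ii.
Qed.

Section DirectSum.
Variables (I : choiceType) (M : I -> lmodType L).

(** A characterization instead of a concrete carrier; the last clause forces finite supports and so
    excludes the full product. *)
Definition is_dsum (D : lmodType L) (inj : forall i, {linear M i -> D})
    (pr : forall i, {linear D -> M i}) : Prop :=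
  [/\ forall i x, pr i (inj i x) = x,
      forall i j x, i != j -> pr j (inj i x) = 0
    & forall x, exists F : seq I, uniq F /\
        x = \sum_(i <- F) inj i (pr i x) ].

Let prod_mod : lmodType L.
unshelve refine (@lmod_pack (forall i, M i) (fun=> 0) (fun x i => - x i)
  (fun x y i => x i + y i) (fun a x i => a *: x i) _ _ _ _ _ _ _ _).
- by move=> x y z; apply: functional_extensionality_dep => i; rewrite addrA.
- by move=> x y; apply: functional_extensionality_dep => i; rewrite addrC.
- by move=> x; apply: functional_extensionality_dep => i; rewrite add0r.
- by move=> x; apply: functional_extensionality_dep => i; rewrite addNr.
- by move=> a b x; apply: functional_extensionality_dep => i; rewrite scalerA.
- by move=> x; apply: functional_extensionality_dep => i; rewrite scale1r.
- by move=> a x y; apply: functional_extensionality_dep => i; rewrite scalerDr.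
- by move=> x a b; apply: functional_extensionality_dep => i; rewrite scalerDl.
Defined.

Let comp i : {linear prod_mod -> M i}.
by unshelve refine (@mklin prod_mod _ (fun x : forall i, M i => x i) _).
Defined.

Lemma exists_dsum : exists D inj pr, @is_dsum D inj pr.
Proof.
pose U (x : prod_mod) := exists F : seq I, forall i, i \notin F -> comp i x = 0.
have [|D [v [vI vP]]] := @exists_sub _ U.
  split; first by exists [::] => i _; rewrite linear0.
  move=> a x y [F Fx] [G Gy]; exists (F ++ G) => i.
  rewrite mem_cat negb_or => /andP[iF iG].
  by rewrite linearP Fx // Gy // scaler0 addr0.
pose pr i : {linear D -> M i} := mklin (f := comp i \o v) (linearP _).
(* The family with [x] at position [i] and 0 elsewhere; to have type [M j], the entry is cast along
   a proof of [i = j]. *)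
pose dl i (x : M i) (j : I) : M j :=
  match @eqP _ i j with ReflectT e => ecast j (M j) e x | _ => 0 end.
have dl_lin i : linear (fun x => dl i x : prod_mod).
  move=> a x y; apply: functional_extensionality_dep => j; rewrite /dl /=.
  change (match @eqP _ i j with ReflectT e => ecast j (M j) e (a *: x + y)
    | _ => 0 end = a *: dl i x j + dl i y j); rewrite /dl.
  by case: eqP => [e|_]; [case: j / e | rewrite scaler0 addr0].
pose dlin i := mklin (dl_lin i).
have dlU i x : exists d, v d = dlin i x.
  apply/vP; exists [:: i] => j; rewrite inE /= /dl => ji.
  change (dl i x j = 0); rewrite /dl; case: eqP => // e.
  by rewrite e eqxx in ji.
have ex_inj i : exists g : {linear M i -> D}, forall x, v (g x) = dlin i x.
  exact: factor_inj.
pose inj i := sval (cid (ex_inj i)).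
have injP i x : v (inj i x) = dlin i x by exact: svalP (cid (ex_inj i)) x.
have prinj i x : pr i (inj i x) = x.
  rewrite /= injP; change (dl i x i = x); rewrite /dl; case: eqP => // e.
  by rewrite (Prop_irrelevance e erefl).
have prinj0 i j x : i != j -> pr j (inj i x) = 0.
  move=> ij; rewrite /= injP; change (dl i x j = 0); rewrite /dl.
  by case: eqP ij => // ->; rewrite eqxx.
exists D, inj, pr; split=> // x.
have [F FP] : U (v x) by apply/vP; exists x.
exists (undup F); split; first exact: undup_uniq.
apply: vI; apply: functional_extensionality_dep => j.
change (pr j x = pr j (\sum_(i <- undup F) inj i (pr i x))).
rewrite linear_sum; case: (boolP (j \in undup F)) => jF.
  rewrite (bigD1_seq j) ?undup_uniq // prinj big1.
    exact/esym/addr0.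
  by move=> i ij; exact: prinj0.
rewrite big_seq big1 => [|i iF]; first by apply: FP; rewrite -mem_undup.
by apply: prinj0; apply: contraNneq jF => <-.
Qed.

End DirectSum.

End LinearMaps.

(** * Exact sequences and finitely generated modules *)

Section Exactness.
Variable L : pzRingType.
Implicit Types A B C E K M N P Q S U V W X Y Z : lmodType L.

Definition surj A B (p : A -> B) : Prop := forall y, exists x, p x = y.

Definition ses A B C (i : {linear A -> B}) (p : {linear B -> C}) : Prop :=
  [/\ injective i, surj p & forall x, p x = 0 <-> exists a, i a = x].

Lemma lin_inj A B (f : {linear A -> B}) :
  (forall x, f x = 0 -> x = 0) -> injective f.
Proof.
move=> f0 x y fxy; apply/eqP; rewrite -subr_eq0; apply/eqP/f0.
by rewrite linearB /= fxy subrr.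
Qed.

Lemma inj_eq0 A B (f : {linear A -> B}) x : injective f -> f x = 0 -> x = 0.
Proof. by move=> fi; rewrite -[RHS](linear0 f) => /fi. Qed.

Lemma ses0 A B C (i : {linear A -> B}) (p : {linear B -> C}) :
  ses i p -> forall a, p (i a) = 0.
Proof. by case=> _ _ e a; apply/e; exists a. Qed.

Lemma ker_submod A B (p : {linear A -> B}) : submod (fun x => p x = 0).
Proof.
split; first exact: linear0.
by move=> a x y px py; rewrite linearP px py scaler0 addr0.
Qed.

Lemma im_submod A B (f : {linear A -> B}) : submod (fun y => exists x, f x = y).
Proof.
split; first by exists 0; exact: linear0.
by move=> a _ _ [x <-] [y <-]; exists (a *: x + y); rewrite linearP.
Qed.

Lemma ses_ker A B (p : {linear A -> B}) : surj p ->
  exists K (i : {linear K -> A}), ses i p.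
Proof. by move=> ps; have [K [i [ii iP]]] := exists_sub (ker_submod p); exists K, i. Qed.

Lemma ses_coker A B (i : {linear A -> B}) : injective i ->
  exists Q (p : {linear B -> Q}), ses i p.
Proof. by move=> ii; have [Q [p [ps pP]]] := exists_quo (im_submod i); exists Q, p. Qed.

Lemma image_factor A B (f : {linear A -> B}) :
  exists V (p : {linear A -> V}) (i : {linear V -> B}),
    [/\ surj p, injective i & forall x, i (p x) = f x].
Proof.
have [V [i [ii iP]]] := exists_sub (im_submod f).
have [p pP] : exists p : {linear A -> V}, forall x, i (p x) = f x.
  by apply: factor_inj => // x; apply/iP; exists x.
exists V, p, i; split=> // y; have /iP [x xy] : exists s, i s = i y by exists y.
by exists x; apply: ii; rewrite pP.
Qed.

Definition mulby M (x : M) : {linear L^o -> M}.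
Proof.
unshelve refine (@mklin L L^o M (fun a : L => a *: x) _).
by move=> a b c /=; rewrite scalerDl scalerA.
Defined.

Definition pairl A B C (f : {linear C -> A}) (g : {linear C -> B}) :
    {linear C -> (A * B)%type}.
Proof.
unshelve refine (@mklin L C (A * B)%type (fun x => (f x, g x)) _).
by move=> a x y; rewrite !linearP.
Defined.

Definition copair A B C (f : {linear A -> C}) (g : {linear B -> C}) :
    {linear (A * B)%type -> C}.
Proof.
unshelve refine (@mklin L (A * B)%type C (fun x => f x.1 + g x.2) _).
by move=> a x y /=; rewrite !linearP scalerDr addrACA.
Defined.

Definition lid A : {linear A -> A} := idfun.
Definition lzero A B : {linear A -> B} := \0.
Definition linl A B : {linear A -> (A * B)%type} := pairl (lid A) (lzero A B).
Definition linr A B : {linear B -> (A * B)%type} := pairl (lzero B A) (lid B).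
Definition lfst A B : {linear (A * B)%type -> A} := copair (lid A) (lzero B A).
Definition lsnd A B : {linear (A * B)%type -> B} := copair (lzero A B) (lid B).
Definition lsub A B (f g : {linear A -> B}) : {linear A -> B}.
Proof.
unshelve refine (@mklin L A B (fun x => f x - g x) _).
by move=> a x y; rewrite (linearP f) (linearP g) scalerBr opprD addrACA.
Defined.

Definition lsum A B (I : Type) (r : seq I) (f : I -> {linear A -> B}) :
  {linear A -> B}.
Proof.
unshelve refine (@mklin L A B (fun x => \sum_(i <- r) f i x) _).
move=> a x y; rewrite scaler_sumr -big_split; apply: eq_bigr => i _.
exact: linearP.
Defined.

Lemma ses_prod A B : ses (linl A B) (lsnd A B).
Proof.
split=> [x y [] //|y|[x y]]; first by exists (0, y); exact: add0r.
split=> [|[z [_ <-]]]; last exact: addr0.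
by rewrite /= add0r => ->; exists x.
Qed.

Lemma projective_lift P M N (p : {linear M -> N}) (g : {linear P -> N}) :
  projective P -> surj p -> exists h : {linear P -> M}, forall x, p (h x) = g x.
Proof. by move=> Pp ps; exact: Pp. Qed.

Lemma projective_regular : projective (L^o : lmodType L).
Proof.
move=> M N p g ps; have [m pm] := ps (g 1); exists (mulby m) => x /=.
by rewrite linearZ /= pm -linearZ /=; congr (g _); exact: mulr1.
Qed.

Lemma projective_retract P Q (s : {linear P -> Q}) (r : {linear Q -> P}) :
  (forall x, r (s x) = x) -> projective Q -> projective P.
Proof.
move=> rs Qp M N p g ps.
have [h hP] := projective_lift (g \o r : {linear Q -> N}) Qp ps.
by exists (h \o s : {linear P -> M}) => x; rewrite hP /= rs.
Qed.

Lemma projective_prod P Q : projective P -> projective Q -> projective (P * Q)%type.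
Proof.
move=> Pp Qp M N p g ps.
have [h hP] := projective_lift (g \o linl P Q : {linear P -> N}) Pp ps.
have [k kP] := projective_lift (g \o linr P Q : {linear Q -> N}) Qp ps.
exists (copair h k) => x; rewrite linearD hP kP /= -linearD.
by case: x => x y; congr (g (_, _)); rewrite ?addr0 ?add0r.
Qed.

End Exactness.

(** * Spans of finite lists and finitely generated modules *)

Section Spans.
Variables (L K : pzRingType) (phi : K -> L) (M : lmodType L).

(** Scalars act through [phi], so that one notion serves both for spans over [L] (with [phi] the
    identity) and for spans over the base ring [k]. *)
Fixpoint lspan (w : seq M) (x : M) : Prop :=
  if w is s :: w' then exists a y, lspan w' y /\ x = phi a *: s + y else x = 0.
End Spans.

Section FinGen.
Variable L : pzRingType.
Implicit Types A B C E M N P Q S U V W X Y Z : lmodType L.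

Lemma lspan_ind M (w : seq M) (U : M -> Prop) :
  submod U -> (forall s, s \in w -> U s) -> forall x, lspan id w x -> U x.
Proof.
move=> [U0 Ul]; elim: w => [|s w IH] Uw x /= => [-> //|[a [y [/IH yw ->]]]].
apply: Ul; first by apply: Uw; rewrite mem_head.
by apply: yw => t tw; apply: Uw; rewrite inE tw orbT.
Qed.

Lemma lspan_submod M (w : seq M) : submod (lspan id w).
Proof.
elim: w => [|s w [IH0 IHl]] /=.
  by split=> // a x y -> ->; rewrite scaler0 addr0.
split; first by exists 0, 0; split=> //; rewrite scale0r addr0.
move=> a _ _ [b [x [wx ->]]] [c [y [wy ->]]].
exists (a * b + c), (a *: x + y); split; first exact: IHl.
by rewrite scalerDr scalerA scalerDl addrACA.
Qed.

Lemma lspan_mem M (w : seq M) s : s \in w -> lspan id w s.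
Proof.
elim: w => [|t w IH] //; rewrite inE => /predU1P[->|/IH sw] /=.
  by exists 1, 0; rewrite scale1r addr0; split=> //; case: (lspan_submod w).
by exists 0, s; rewrite scale0r add0r.
Qed.

Lemma lspan_sub M (w v : seq M) x :
  {subset w <= v} -> lspan id w x -> lspan id v x.
Proof.
by move=> wv; apply: lspan_ind (lspan_submod v) _ _ => s /wv; exact: lspan_mem.
Qed.

Lemma fin_genP M : fin_gen M <-> exists w : seq M, forall x, lspan id w x.
Proof.
split=> [[n [s sP]]|[w wP]].
  exists [seq s i | i <- enum 'I_n] => x; have [c ->] := sP x.
  have [U0 Ul] := lspan_submod [seq s i | i <- enum 'I_n].
  elim/big_ind: _ => // [y z yw zw|i _]; first by rewrite -[y]scale1r; exact: Ul.
  rewrite -[_ *: _]addr0; apply: Ul => //.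
  by apply: lspan_mem; rewrite map_f ?mem_enum.
exists (size w), (tnth (in_tuple w)) => x; have := wP x.
elim: {wP} w x => [|s w IH] x /= => [->|[a [y [/IH [c ->] ->]]]].
  by exists (fun=> 0); rewrite big_ord0.
exists (fun i => if unlift ord0 i is Some j then c j else a).
rewrite big_ord_recl unlift_none /=; congr (_ + _); apply: eq_bigr => i _.
by rewrite liftK !(tnth_nth 0).
Qed.

Lemma fg_surj M N (p : {linear M -> N}) : surj p -> fin_gen M -> fin_gen N.
Proof.
move=> ps [n [s sP]]; exists n, (p \o s) => y; have [x <-] := ps y.
have [c ->] := sP x; exists c; rewrite linear_sum; apply: eq_bigr => i _.
by rewrite linearZ.
Qed.

Lemma surj_map A B (p : A -> B) (w : seq B) : surj p -> exists v, map p v = w.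
Proof.
move=> ps; elim: w => [|b w [v <-]]; first by exists [::].
by have [a <-] := ps b; exists (a :: v).
Qed.

Lemma fg_ext A B C (i : {linear A -> B}) (p : {linear B -> C}) :
  ses i p -> fin_gen A -> fin_gen C -> fin_gen B.
Proof.
move=> [ii ps e] /fin_genP[u uP] /fin_genP[v vP]; apply/fin_genP.
have [w wv] := surj_map v ps.
exists ([seq i a | a <- u] ++ w) => b.
have [b' [b'w pb']] : exists b', lspan id w b' /\ p b' = p b.
  apply: (lspan_ind (U := fun c => exists b', lspan id w b' /\ p b' = c)) (vP (p b)).
    split; first by exists 0; split; [case: (lspan_submod w) | exact: linear0].
    move=> a x y [x' [wx <-]] [y' [wy <-]]; exists (a *: x' + y').
    by split; [case: (lspan_submod w) => _; apply | rewrite linearP].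
  rewrite -wv => _ /mapP[s sw ->]; exists s; split=> //; exact: lspan_mem.
have /e [a ia] : p (b - b') = 0 by rewrite linearB /= pb' subrr.
have -> : b = 1 *: i a + b' by rewrite scale1r ia subrK.
have [_ Ul] := lspan_submod ([seq i a | a <- u] ++ w).
apply: (Ul); last by apply: lspan_sub b'w => s sw; rewrite mem_cat sw orbT.
apply: (@lspan_ind _ u (fun a => lspan id ([seq i a | a <- u] ++ w) (i a))) (uP a).
  split; first by rewrite linear0; case: (lspan_submod ([seq i a | a <- u] ++ w)).
  by move=> c x y ux uy; rewrite linearP; exact: Ul.
by move=> s su; apply: lspan_mem; rewrite mem_cat map_f.
Qed.

Lemma fg_trivial M : (forall x : M, x = 0) -> fin_gen M.
Proof. by move=> M0; apply/fin_genP; exists [::]. Qed.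

Lemma fg_regular : fin_gen (L^o : lmodType L).
Proof.
apply/fin_genP; exists [:: 1] => x; exists x, 0; split=> //.
by rewrite addr0; exact/esym/mulr1.
Qed.

Lemma fg_prod A B : fin_gen A -> fin_gen B -> fin_gen (A * B)%type.
Proof. exact/fg_ext/ses_prod. Qed.

Lemma exists_trivial : exists Z, forall x : Z, x = 0.
Proof.
have [|Z [i [ii iP]]] := @exists_sub L L^o (fun x => x = 0).
  by split=> // a x y -> ->; rewrite scaler0 addr0.
by exists Z => x; apply/(inj_eq0 ii)/iP; exists x.
Qed.

Lemma free_on_seq M (w : seq M) : exists P (p : {linear P -> M}),
  [/\ projective P, fin_gen P & forall x, lspan id w x <-> exists y, p y = x].
Proof.
elim: w => [|s w [P [p [Pp Pf pw]]]].
  have [Z Z0] := exists_trivial; exists Z, (lzero Z M); split.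
  - by move=> A B g h _; exists (lzero Z A) => x; rewrite (Z0 x) !linear0.
  - exact: fg_trivial.
  - by move=> x; split=> [->|[y <-] //]; exists 0.
exists (L^o * P)%type, (copair (mulby s) p); split.
- exact: (projective_prod (@projective_regular L) Pp).
- exact: fg_prod fg_regular Pf.
- move=> x; split=> [[a [y [/pw [z <-] ->]]]|[[a z] <-]]; first by exists (a, z).
  by exists a, (p z); split=> //; apply/pw; exists z.
Qed.

Lemma fg_cover M : fin_gen M ->
  exists P (p : {linear P -> M}), [/\ projective P, fin_gen P & surj p].
Proof.
move/fin_genP=> [w wP]; have [P [p [Pp Pf pw]]] := free_on_seq w.
by exists P, p; split=> // x; apply/pw.
Qed.

Lemma fg_lift M E (p : {linear E -> M}) : surj p -> fin_gen M ->
  exists N (g : {linear N -> E}), fin_gen N /\ forall x, exists n, p (g n) = x.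
Proof.
move=> ps /fg_cover [P [q [Pp Pf qs]]]; have [g gP] := projective_lift q Pp ps.
by exists P, g; split=> // x; have [y <-] := qs x; exists y.
Qed.

End FinGen.

(** * Supports, universal property and finite partial sums of direct sums *)

Section DirectSumTheory.
Variables (L : pzRingType) (I : choiceType) (M : I -> lmodType L).
Variables (D : lmodType L) (inj : forall i, {linear M i -> D})
  (pr : forall i, {linear D -> M i}).
Hypothesis dsumD : is_dsum inj pr.

Lemma dsum_prK i x : pr i (inj i x) = x.
Proof. by case: dsumD. Qed.

Lemma dsum_pr0 i j x : i != j -> pr j (inj i x) = 0.
Proof. by case: dsumD => _ H _; exact: H. Qed.

Lemma dsum_supp x : exists F : seq I, forall i, i \notin F -> pr i x = 0.
Proof.
case: dsumD => _ _ /(_ x) [F [_ xF]]; exists F => j jF.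
rewrite xF linear_sum big_seq big1 // => i iF; apply: dsum_pr0.
by apply: contraNneq jF => <-.
Qed.

Lemma dsum_pr_sum (N : forall i, M i) (F : seq I) j : uniq F ->
  pr j (\sum_(i <- F) inj i (N i)) = if j \in F then N j else 0.
Proof.
move=> uF; rewrite linear_sum; case: ifP => jF.
  rewrite (bigD1_seq j) // dsum_prK big1; first exact: addr0.
  by move=> i ij; exact: dsum_pr0.
rewrite big_seq big1 // => i iF; apply: dsum_pr0.
by apply: contraFneq jF => <-.
Qed.

Lemma dsum_eq0 x : (forall i, pr i x = 0) -> x = 0.
Proof.
case: dsumD => _ _ /(_ x) [F [_ xF]] x0.
by rewrite xF big1 // => i _; rewrite x0 linear0.
Qed.

Lemma dsum_sumE x (F : seq I) : uniq F -> (forall i, i \notin F -> pr i x = 0) ->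
  x = \sum_(i <- F) inj i (pr i x).
Proof.
move=> uF xF; apply/eqP; rewrite -subr_eq0; apply/eqP/dsum_eq0 => i.
rewrite linearB dsum_pr_sum //=; case: ifPn => [_|/xF ->]; exact: subrr.
Qed.

Lemma dsum_lift (N : lmodType L) (g : forall i, {linear M i -> N}) :
  exists h : {linear D -> N}, forall i x, h (inj i x) = g i x.
Proof.
(* Enlarging the index list beyond the support leaves the sum unchanged, so two elements can be
   compared over a common list. *)
have sumE x (F G : seq I) : uniq F -> uniq G -> {subset F <= G} ->
    (forall i, i \notin F -> pr i x = 0) ->
    \sum_(i <- F) g i (pr i x) = \sum_(i <- G) g i (pr i x).
  move=> uF uG FG xF; rewrite [RHS](bigID (mem F)) /= [X in _ + X]big1 ?addr0.
    rewrite -[RHS]big_filter; apply: perm_big; apply: uniq_perm => //.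
      exact: filter_uniq.
    by move=> i; rewrite mem_filter /=; case: (boolP (i \in F)) => // /FG.
  by move=> i /xF ->; rewrite linear0.
have [h hP] : exists h : {linear D -> N}, forall x, exists F, [/\ uniq F,
    forall i, i \notin F -> pr i x = 0 & h x = \sum_(i <- F) g i (pr i x)].
  apply: (lin_of_rel (R := fun x y => exists F, [/\ uniq F,
    forall i, i \notin F -> pr i x = 0 & y = \sum_(i <- F) g i (pr i x)])).
  - move=> a x x' _ _ [F [uF xF ->]] [G [uG xG ->]].
    exists (undup (F ++ G)); split; first exact: undup_uniq.
      move=> i; rewrite mem_undup mem_cat negb_or => /andP[iF iG].
      by rewrite linearP xF // xG // scaler0 addr0.
    rewrite (sumE x F (undup (F ++ G))) ?undup_uniq //; last first.
      by move=> i iF; rewrite mem_undup mem_cat iF.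
    rewrite (sumE x' G (undup (F ++ G))) ?undup_uniq //; last first.
      by move=> i iF; rewrite mem_undup mem_cat iF orbT.
    rewrite scaler_sumr -big_split; apply: eq_bigr => i _ /=.
    by rewrite !linearP.
  - move=> x; have [F xF] := dsum_supp x.
    exists (\sum_(i <- undup F) g i (pr i x)), (undup F).
    by split=> //; [exact: undup_uniq | move=> i; rewrite mem_undup; exact: xF].
  - by move=> y [F [_ _ ->]]; apply: big1 => i _; rewrite !linear0.
exists h => i x; have [F [uF xF ->]] := hP (inj i x).
case: (boolP (i \in F)) => iF.
  rewrite (bigD1_seq i) //= dsum_prK big1 ?addr0 // => j ji.
  by rewrite dsum_pr0 ?linear0 // eq_sym.
have -> : g i x = 0 by rewrite -[x]dsum_prK xF // linear0.
rewrite big_seq big1 // => j jF.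
by rewrite dsum_pr0 ?linear0 //; apply: contraNneq iF => ->.
Qed.

Lemma dsum_ext (N : lmodType L) (f g : {linear D -> N}) :
  (forall i x, f (inj i x) = g (inj i x)) -> forall x, f x = g x.
Proof.
move=> fg x; case: dsumD => _ _ /(_ x) [F [_ ->]].
by rewrite !linear_sum; apply: eq_bigr => i _; rewrite fg.
Qed.

Lemma dsum_fg_supp (N : lmodType L) (g : {linear N -> D}) : fin_gen N ->
  exists F : seq I, uniq F /\ forall n i, i \notin F -> pr i (g n) = 0.
Proof.
move=> /fin_genP [w wP].
suff [F FP] : exists F : seq I, forall s, s \in w -> forall i, i \notin F -> pr i (g s) = 0.
  exists (undup F); split=> [|n i]; first exact: undup_uniq.
  rewrite mem_undup => iF.
  apply: (lspan_ind (U := fun n => pr i (g n) = 0)) (wP n).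
    split; first by rewrite !linear0.
    by move=> a x y ex ey; rewrite !linearP ex ey scaler0 addr0.
  by move=> s sw; exact: FP.
elim: {wP} w => [|s w [F FP]]; first by exists [::].
have [G GP] := dsum_supp (g s); exists (G ++ F) => t.
rewrite inE => /predU1P[->|tw] i; rewrite mem_cat negb_or => /andP[iG iF].
  exact: GP.
exact: FP.
Qed.

(* Isomorphism invariance of T is the case of closure under extensions by
   trivial modules. *)
Lemma dsum_partial (T : lmodType L -> Prop) :
    (forall Z : lmodType L, (forall x : Z, x = 0) -> T Z) ->
    (forall (A B C : lmodType L) (i : {linear A -> B}) (p : {linear B -> C}),
      ses i p -> T A -> T C -> T B) ->
    (forall i, T (M i)) ->
  forall F : seq I, exists (A : lmodType L) (j : {linear A -> D}), [/\ T A, injective j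
    & forall x, (exists a, j a = x) <-> forall i, i \notin F -> pr i x = 0].
Proof.
move=> T0 Text TM F.
have sub (G : seq I) : submod (fun x => forall i, i \notin G -> pr i x = 0).
  split=> [i _|a x y xG yG i iG]; first exact: linear0.
  by rewrite linearP xG // yG // scaler0 addr0.
elim: F => [|k F [A [j [TA ji jP]]]].
  have [A [j [ji jP]]] := exists_sub (sub [::]); exists A, j; split=> //.
    apply: T0 => a; apply: (inj_eq0 ji); apply: dsum_eq0 => i.
    by have /jP /(_ i) : exists s, j s = j a by [exists a]; apply.
  by move=> x; split=> /jP.
case: (boolP (k \in F)) => kF.
  exists A, j; split=> // x; rewrite jP; split=> xF i iF; apply: xF.
    by move: iF; rewrite inE negb_or => /andP[].
  by rewrite inE negb_or iF andbT; apply: contraNneq iF => ->.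
have [B [l [li lP]]] := exists_sub (sub (k :: F)).
exists B, l; split=> // [|x]; last by split=> /lP.
have [u uP] : exists u : {linear A -> B}, forall a, l (u a) = j a.
  apply: factor_inj => // a; apply/lP => i; rewrite inE negb_or => /andP[_].
  by apply: (jP (j a)).1; exists a.
apply: (Text A B (M k) u (pr k \o l : {linear B -> M k})) => //; split.
- by move=> x y uxy; apply: ji; rewrite -!uP uxy.
- move=> x; have /lP [b lb] : forall i, i \notin k :: F -> pr i (inj k x) = 0.
    by move=> i; rewrite inE negb_or => /andP[ik _]; rewrite dsum_pr0 // eq_sym.
  by exists b; rewrite /= lb dsum_prK.
- move=> b; split=> [/= kb|[a <-] /=]; last first.
    by rewrite uP; apply: (jP (j a)).1 => //; exists a.
  have /jP [a ja] : forall i, i \notin F -> pr i (l b) = 0.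
    move=> i iF; have [->//|ik] := eqVneq i k.
    have /lP : exists s, l s = l b by exists b.
    by apply; rewrite inE negb_or ik.
  by exists a; apply: li; rewrite uP.
Qed.

End DirectSumTheory.

(** * Projective dimension *)

Section ProjectiveDimension.
Variable L : pzRingType.
Implicit Types A B C D E G K M N P Q S U V W X Y Z : lmodType L.

Lemma ses_of_iso A B Z (f : {linear A -> B}) :
  injective f -> surj f -> (forall z : Z, z = 0) -> ses (lzero Z A) f.
Proof.
move=> fi fs Z0; split=> // [x y _|x]; first by rewrite (Z0 x) (Z0 y).
by split=> [/(inj_eq0 fi) ->|[z <-]]; [exists 0 | exact: linear0].
Qed.

Lemma pullback_ses K A C B (i : {linear K -> A}) (p : {linear A -> C})
    (q : {linear B -> C}) : ses i p ->
  exists W (j : {linear K -> W}) (b : {linear W -> B}) (a : {linear W -> A}),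
    [/\ ses j b, forall w, p (a w) = q (b w), forall k, a (j k) = i k
      & forall x y, p x = q y -> exists w, a w = x /\ b w = y].
Proof.
move=> [ii ps e].
pose d : {linear (A * B)%type -> C} := lsub (p \o @lfst L A B) (q \o @lsnd L A B).
have dE x y : d (x, y) = p x - q y by rewrite /= addr0 add0r.
have [W [w [wi wP]]] := exists_sub (ker_submod d).
have [a [b wE]] : exists (a : {linear W -> A}) (b : {linear W -> B}),
    forall x, w x = (a x, b x).
  exists (@lfst L A B \o w), (@lsnd L A B \o w) => x.
  by rewrite /= addr0 add0r; case: (w x).
have Wex x y : p x = q y -> exists t, a t = x /\ b t = y.
  move=> pq; have /wP [t wt] : d (x, y) = 0 by rewrite dE pq subrr.
  by exists t; move: wt; rewrite wE => -[-> ->].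
have ab t : p (a t) = q (b t).
  apply/eqP; rewrite -subr_eq0 -dE -wE; apply/eqP/wP; by exists t.
have winj t : a t = 0 -> b t = 0 -> t = 0.
  by move=> at0 bt0; apply: (inj_eq0 wi); rewrite wE at0 bt0.
have [j jP] : exists j : {linear K -> W}, forall k, w (j k) = linl A B (i k).
  apply: (factor_inj (f := linl A B \o i)) => // k; apply/wP.
  rewrite -[_ k]/(i k, 0) dE linear0 subr0; apply/e; by exists k.
have ajb k : a (j k) = i k /\ b (j k) = 0.
  by have := jP k; rewrite wE => -[-> ->].
exists W, j, b, a; split=> // [|k]; last by have [] := ajb k.
split.
- by apply: lin_inj => k jk; apply: (inj_eq0 ii); have [<- _] := ajb k; rewrite jk linear0.
- by move=> y; have [x xy] := ps (q y); have [t [_ tb]] := Wex x y xy; exists t.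
- move=> t; split=> [bt|[k <-]]; last by have [] := ajb k.
  have /e [k kt] : p (a t) = 0 by rewrite ab bt linear0.
  exists k; apply/eqP; rewrite -subr_eq0; apply/eqP/winj.
    by rewrite linearB /= (ajb k).1 kt subrr.
  by rewrite linearB /= (ajb k).2 bt subrr.
Qed.

Lemma pushout_ses A B Z C (i : {linear A -> B}) (p : {linear B -> Z})
    (f : {linear A -> C}) : ses i p ->
  exists G (v : {linear C -> G}) (r : {linear G -> Z}) (u : {linear B -> G}),
    [/\ ses v r, forall b, r (u b) = p b, forall a, u (i a) = v (f a)
      & forall g, exists b c, g = u b + v c].
Proof.
move=> ses_ip; have [ii ps e] := ses_ip.
pose h : {linear A -> (B * C)%type} := lsub (linl B C \o i) (linr B C \o f).
have hE a : h a = (i a, - f a) by congr (_, _); rewrite /= ?subr0 ?sub0r.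
have hi : injective h.
  by apply: lin_inj => a; rewrite hE => -[/(inj_eq0 ii)].
have [G [g [_ gs ge]]] := ses_coker hi.
have [u [v gE]] : exists (u : {linear B -> G}) (v : {linear C -> G}),
    forall b c, g (b, c) = u b + v c.
  exists (g \o linl B C), (g \o linr B C) => b c.
  by rewrite -[RHS](linearD g); congr (g (_, _)); rewrite /= ?addr0 ?add0r.
have uv a : u (i a) = v (f a).
  apply/eqP; rewrite -subr_eq0 -(linearN v) -gE; apply/eqP/ge; exists a; exact: hE.
have gen x : exists b c, x = u b + v c.
  by have [[b c] <-] := gs x; exists b, c; exact: gE.
have [r rP] : exists r : {linear G -> Z}, forall x, r (g x) = (p \o @lfst L B C) x.
  apply: factor_surj => // x /ge [a <-]; rewrite hE /= addr0; exact: ses0 ses_ip a.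
have ru b : r (u b) = p b.
  by have := rP (b, 0); rewrite gE (linear0 v) addr0 /= addr0.
have rv c : r (v c) = 0.
  by have := rP (0, c); rewrite gE (linear0 u) add0r /= addr0 linear0.
exists G, v, r, u; split=> //; split.
- apply: lin_inj => c gc; have /ge [a] : g (0, c) = 0 by rewrite gE linear0 add0r.
  by rewrite hE => -[/(inj_eq0 ii) -> <-]; rewrite linear0 oppr0.
- by move=> z; have [b <-] := ps z; exists (u b).
- move=> x; split=> [|[c <-] //]; have [b [c ->]] := gen x.
  rewrite linearD ru rv addr0 => /e [a <-]; exists (f a + c).
  by rewrite linearD uv.
Qed.

Definition retract U W : Prop :=
  exists (s : {linear U -> W}) (r : {linear W -> U}), forall x, r (s x) = x.

Lemma ses_section_retraction A B C (i : {linear A -> B}) (p : {linear B -> C})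
    (s : {linear C -> B}) : ses i p -> (forall c, p (s c) = c) ->
  exists r : {linear B -> A}, (forall a, r (i a) = a) /\
    forall b, b = i (r b) + s (p b).
Proof.
move=> ip ps; have [ii _ e] := ip.
have [r rP] : exists r : {linear B -> A}, forall b, i (r b) = lsub (lid B) (s \o p) b.
  by apply: factor_inj => // b; apply/e; rewrite /= linearB /= ps subrr.
exists r; split=> [a|b]; last by rewrite rP /= subrK.
by apply: ii; rewrite rP /= (ses0 ip) linear0 subr0.
Qed.

Lemma ses_retraction_section A B C (i : {linear A -> B}) (p : {linear B -> C})
    (r : {linear B -> A}) : ses i p -> (forall a, r (i a) = a) ->
  exists s : {linear C -> B}, forall c, p (s c) = c.
Proof.
move=> ip ri; have [ii ps e] := ip.
have [s sP] : exists s : {linear C -> B}, forall b, s (p b) = lsub (lid B) (i \o r) b.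
  by apply: factor_surj => // b /e [a <-]; rewrite /= ri subrr.
exists s => c; have [b <-] := ps c.
by rewrite sP /= linearB /= (ses0 ip) subr0.
Qed.

Lemma retract_complement U W (s : {linear U -> W}) (r : {linear W -> U}) :
  (forall x, r (s x) = x) -> exists V (i : {linear V -> W}), ses i r.
Proof. by move=> rs; apply: ses_ker => u; exists (s u). Qed.

(** Projective dimension at most [d], by recursion on syzygies, which suits induction better than
    resolutions; [pdim_pdle] links it to [pdim]. *)
Fixpoint pdle (d : nat) (Z : lmodType L) : Prop :=
  if d is d'.+1 then
    exists P K (i : {linear K -> P}) (p : {linear P -> Z}),
      [/\ projective P, ses i p & pdle d' K]
  else projective Z.

Lemma projective_trivial Z : (forall x : Z, x = 0) -> projective Z.
Proof.
by move=> Z0 M N p g _; exists (lzero Z M) => x; rewrite (Z0 x) !linear0.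
Qed.

Lemma projective_ext A B C (i : {linear A -> B}) (p : {linear B -> C}) :
  ses i p -> projective A -> projective C -> projective B.
Proof.
move=> ip Ap Cp; have [ii ps e] := ip.
have [s sP] := projective_lift (lid C) Cp ps.
have [r [ri rs]] := ses_section_retraction ip sP.
apply: (projective_retract (s := pairl r p) (r := copair i s)).
  by move=> x; rewrite [RHS]rs.
exact: projective_prod.
Qed.

(** Horseshoe lemma: [P * R] maps onto [B], and the kernel [N] is an extension of the syzygy [H] of
    [C] by the syzygy [K] of [A]. *)
Lemma pdle_ext d A B C (i : {linear A -> B}) (p : {linear B -> C}) :
  ses i p -> pdle d A -> pdle d C -> pdle d B.
Proof.
elim: d A B C i p => [|d IH] A B C i p; first exact: projective_ext.
move=> ip [P [K [k [q [Pp kq Kd]]]]] [R [H [h [t [Rp ht Hd]]]]].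
have [ii ps e] := ip; have [ki qs ke] := kq; have [hi ts he] := ht.
have [l lP] := projective_lift t Rp ps.
pose u : {linear (P * R)%type -> B} := copair (i \o q) l.
have us : surj u.
  move=> b; have [y yb] := ts (p b).
  have /e [a ab] : p (b - l y) = 0 by rewrite linearB /= lP yb subrr.
  by have [x xa] := qs a; exists (x, y); rewrite /= xa ab subrK.
have [N [n nu]] := ses_ker us; have [ni _ ne] := nu.
have [f fP] : exists f : {linear K -> N}, forall x, n (f x) = (linl P R \o k) x.
  apply: factor_inj => // x; apply/ne.
  by rewrite /= (ses0 kq) !linear0 addr0.
have [g gP] : exists g : {linear N -> H}, forall x, h (g x) = (@lsnd L P R \o n) x.
  apply: factor_inj => // x; apply/he; rewrite /= add0r -lP.
  have := congr1 p (ses0 nu x); rewrite linearD linear0 /=.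
  by rewrite (ses0 ip) add0r.
exists (P * R)%type, N, n, u; split=> //; first exact: projective_prod.
apply: (IH _ _ _ f g) => //; split.
- by move=> x y fxy; apply: ki; have := fP y; rewrite -fxy fP => -[].
- move=> y; have /e [a ap] : p (l (h y)) = 0 by rewrite lP (ses0 ht).
  have [x xa] := qs a.
  have /ne [z zP] : u (- x, h y) = 0 by rewrite /= !linearN /= xa ap addNr.
  by exists z; apply: hi; rewrite gP /= zP add0r.
- move=> z; split=> [gz|[x <-]]; last first.
    by apply: (inj_eq0 hi); rewrite gP /= fP /= addr0.
  have n2 : (n z).2 = 0 by have := gP z; rewrite gz linear0 /= add0r.
  have /ke [x xP] : q (n z).1 = 0.
    by apply: (inj_eq0 ii); have := ses0 nu z; rewrite /= n2 linear0 addr0.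
  exists x; apply: ni; rewrite fP /= xP; move: n2; case: (n z) => a b /= ->.
  by [].
Qed.

Lemma pdleS d Z : pdle d Z -> pdle d.+1 Z.
Proof.
elim: d Z => [|d IH] Z.
  have [O O0] := exists_trivial L; move=> Zp.
  exists Z, O, (lzero O Z), (lid Z); split=> //; last exact: projective_trivial.
  by apply: ses_of_iso => // x; exists x.
by move=> [P [K [i [p [Pp ip /IH Kd]]]]]; exists P, K, i, p.
Qed.

Lemma pdle_leq d e Z : (d <= e)%N -> pdle d Z -> pdle e Z.
Proof. by move/subnK<-; elim: (e - d)%N => // n IH /IH /pdleS. Qed.

Lemma pdle_trivial d Z : (forall x : Z, x = 0) -> pdle d Z.
Proof. by move=> Z0; apply: (@pdle_leq 0) => //; exact: projective_trivial. Qed.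


(** The free module on the set of all elements of [Z]; no minimality is meant by the name. *)
Lemma exists_projective_cover Z :
  exists P (p : {linear P -> Z}), projective P /\ surj p.
Proof.
have [D [inj [pr dD]]] := exists_dsum (fun _ : Z => L^o).
have [h hP] := dsum_lift dD (fun z => mulby z).
exists D, h; split=> [M N p g ps|z]; last by exists (inj z 1); rewrite hP /= scale1r.
have ex z := projective_lift (g \o inj z : {linear L^o -> N}) (@projective_regular L) ps.
have [f fP] := dsum_lift dD (fun z => sval (cid (ex z))).
exists f; apply: (dsum_ext dD (f := p \o f)) => z x /=.
by rewrite fP; exact: svalP (cid (ex z)) x.
Qed.

(* Simultaneous induction: by Schanuel a syzygy of Z is a retract of an
   extension of a projective module by a syzygy of dimension d, and a retract
   at level d.+1 is handled through a syzygy of the whole module. *)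
Lemma pdle_syzygy_retract d :
  (forall U W, retract U W -> pdle d W -> pdle d U) /\
  (forall K P Z (i : {linear K -> P}) (p : {linear P -> Z}),
    ses i p -> projective P -> pdle d.+1 Z -> pdle d K).
Proof.
have syz e : (forall U W, retract U W -> pdle e W -> pdle e U) ->
    forall K P Z (i : {linear K -> P}) (p : {linear P -> Z}),
    ses i p -> projective P -> pdle e.+1 Z -> pdle e K.
  move=> ret K P Z i p ip Pp [Q [H [h [q [Qp hq Hd]]]]].
  (* [W] is the pullback of [P] and [Q] over [Z]. Its projection to the projective [Q] splits off
     [K]; its projection to [P] has a kernel [N] isomorphic to [H]. *)
  have [W [j [b [a [jb ab aj Wex]]]]] := pullback_ses q ip.
  have [ji bs be] := jb; have [s sP] := projective_lift (lid Q) Qp bs.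
  have [r [rj _]] := ses_section_retraction jb sP.
  apply: (ret K W); first by exists j, r.
  have [ii ps ie] := ip; have [hi qs he] := hq.
  have as_ : surj a.
    by move=> x; have [y yx] := qs (p x); have [w [<- _]] := Wex x y (esym yx); exists w.
  have [N [n na]] := ses_ker as_; have [ni _ ne] := na.
  apply: (pdle_ext na); last by apply: (@pdle_leq 0).
  apply: (ret N H) => //.
  have [f fP] : exists f : {linear N -> H}, forall x, h (f x) = (b \o n) x.
    by apply: factor_inj => // x; apply/he; rewrite /= -ab (ses0 na) linear0.
  have fi : injective f.
    apply: lin_inj => x fx; apply: (inj_eq0 ni).
    have /be [k kx] : b (n x) = 0 by rewrite -[LHS]fP fx linear0.
    rewrite -kx; suff -> : k = 0 by rewrite linear0.
    by apply: (inj_eq0 ii); rewrite -aj kx (ses0 na).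
  have [g gP] : exists g : {linear H -> N}, forall y, f (g y) = lid H y.
    apply: factor_inj => // y; have [w [w0 wy]] : exists w, a w = 0 /\ b w = h y.
      by apply: Wex; rewrite linear0 (ses0 hq).
    have /ne [x xw] := w0; exists x; apply: hi; rewrite fP /= xw; exact: wy.
  by exists f, g => x; apply: fi; rewrite gP.
elim: d => [|d [ret' syz']]; last first.
  suff ret : forall U W, retract U W -> pdle d.+1 W -> pdle d.+1 U.
    by split=> //; exact: syz.
  move=> U W [s [r rs]] Wd.
  have [V [j jr]] := retract_complement rs; have [ji _ je] := jr.
  have [P [p [Pp ps]]] := exists_projective_cover U.
  have [Q [q [Qp qs]]] := exists_projective_cover V.
  pose t : {linear (P * Q)%type -> W} := copair (s \o p) (j \o q).
  have ts : surj t.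
    move=> w; have [x xw] := ps (r w).
    have /je [v vw] : r (w - s (r w)) = 0 by rewrite linearB /= rs subrr.
    by have [y yv] := qs v; exists (x, y); rewrite /= xw yv vw addrC subrK.
  have [K [k kp]] := ses_ker ps; have [ki _ ke] := kp.
  have [H [h ht]] := ses_ker ts; have [hi _ he] := ht.
  exists P, K, k, p; split=> //; apply: (ret' K H).
    have [f fP] : exists f : {linear K -> H}, forall x, h (f x) = (linl P Q \o k) x.
      by apply: factor_inj => // x; apply/he; rewrite /= (ses0 kp) !linear0 addr0.
    have [g gP] : exists g : {linear H -> K}, forall x, k (g x) = (@lfst L P Q \o h) x.
      apply: factor_inj => // x; apply/ke; rewrite /= addr0.
      have := congr1 r (ses0 ht x); rewrite /= linearD /= rs linear0.
      by rewrite (ses0 jr) addr0.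
    by exists f, g => x; apply: ki; rewrite gP /= fP /= addr0.
  apply: (syz' _ _ _ h t) => //; exact: projective_prod.
have ret : forall U W, retract U W -> pdle 0 W -> pdle 0 U.
  by move=> U W [s [r rs]]; exact: projective_retract rs.
by split=> //; exact: syz.
Qed.

Lemma pdle_retract d U W : retract U W -> pdle d W -> pdle d U.
Proof. exact: (pdle_syzygy_retract d).1. Qed.

Lemma pdle_syzygy d K P Z (i : {linear K -> P}) (p : {linear P -> Z}) :
  ses i p -> projective P -> pdle d.+1 Z -> pdle d K.
Proof. exact: (pdle_syzygy_retract d).2. Qed.

(** The kernel of the composite [P -> B -> C] is an extension of [A] by the syzygy [K] of [B].
    Passing to [d.+1] for [B] provides such a syzygy even when [d] is 0. *)
Lemma pdle_coker d A B C (i : {linear A -> B}) (p : {linear B -> C}) :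
  ses i p -> pdle d A -> pdle d B -> pdle d.+1 C.
Proof.
move=> ip Ad /pdleS [P [K [k [q [Pp kq Kd]]]]].
have [ii ps e] := ip; have [ki qs ke] := kq.
have pqs : surj (p \o q : {linear P -> C}).
  by move=> c; have [b <-] := ps c; have [x <-] := qs b; exists x.
have [N [n npq]] := ses_ker pqs; have [ni _ ne] := npq.
exists P, N, n, (p \o q : {linear P -> C}); split=> //.
have [f fP] : exists f : {linear K -> N}, forall x, n (f x) = k x.
  by apply: factor_inj => // x; apply/ne; rewrite /= (ses0 kq) linear0.
have [g gP] : exists g : {linear N -> A}, forall x, i (g x) = (q \o n) x.
  by apply: factor_inj => // x; apply/e; exact: (ses0 npq).
apply: (pdle_ext (i := f) (p := g)) => //; split.
- by move=> x y fxy; apply: ki; rewrite -!fP fxy.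
- move=> a; have [x xa] := qs (i a).
  have /ne [y yx] : (p \o q) x = 0 by rewrite /= xa (ses0 ip).
  by exists y; apply: ii; rewrite gP /= yx.
- move=> y; split=> [gy|[x <-]]; last first.
    by apply: (inj_eq0 ii); rewrite gP /= fP (ses0 kq).
  have /ke [x xy] : q (n y) = 0 by have := gP y; rewrite gy linear0.
  by exists x; apply: ni; rewrite fP.
Qed.

Lemma dsum_ses (I : choiceType) (A B C : I -> lmodType L)
    (i : forall k, {linear A k -> B k}) (p : forall k, {linear B k -> C k})
    (DA DB DC : lmodType L)
    (ja : forall k, {linear A k -> DA}) (qa : forall k, {linear DA -> A k})
    (jb : forall k, {linear B k -> DB}) (qb : forall k, {linear DB -> B k})
    (jc : forall k, {linear C k -> DC}) (qc : forall k, {linear DC -> C k}) :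
    is_dsum ja qa -> is_dsum jb qb -> is_dsum jc qc ->
    (forall k, ses (i k) (p k)) ->
  exists (f : {linear DA -> DB}) (g : {linear DB -> DC}),
    [/\ ses f g, forall k x, f (ja k x) = jb k (i k x)
      & forall k x, g (jb k x) = jc k (p k x)].
Proof.
move=> dA dB dC ip.
have [f fP] := dsum_lift dA (fun k => jb k \o i k : {linear _ -> _}).
have [g gP] := dsum_lift dB (fun k => jc k \o p k : {linear _ -> _}).
have fq k x : qb k (f x) = i k (qa k x).
  apply: (dsum_ext dA (f := qb k \o f) (g := i k \o qa k)) => l y /=.
  rewrite fP /=; have [<-|kl] := eqVneq l k; first by rewrite !dsum_prK.
  by rewrite (dsum_pr0 dB) // (dsum_pr0 dA) // linear0.
have gq k x : qc k (g x) = p k (qb k x).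
  apply: (dsum_ext dB (f := qc k \o g) (g := p k \o qb k)) => l y /=.
  rewrite gP /=; have [<-|kl] := eqVneq l k; first by rewrite !dsum_prK.
  by rewrite (dsum_pr0 dC) // (dsum_pr0 dB) // linear0.
exists f, g; split=> //; split.
- apply: lin_inj => x fx; apply: (dsum_eq0 dA) => k.
  by have [ii _ _] := ip k; apply: (inj_eq0 ii); rewrite -fq fx linear0.
- move=> y; have [F yF] := dsum_supp dC y.
  have ex k : exists b, p k b = qc k y by have [_ ps _] := ip k; exact: ps.
  exists (\sum_(k <- undup F) jb k (sval (cid (ex k)))).
  rewrite linear_sum [RHS](dsum_sumE dC (undup_uniq F) (x := y)); last first.
    by move=> k; rewrite mem_undup; exact: yF.
  by apply: eq_bigr => k _; rewrite gP /=; congr (jc k _); exact: svalP (cid (ex k)).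
- move=> y; split=> [gy|[x <-]]; last first.
    by apply: (dsum_eq0 dC) => k; rewrite gq fq (ses0 (ip k)).
  have ex k : exists a, i k a = qb k y.
    by have [_ _ e] := ip k; apply/e; rewrite -gq gy linear0.
  have [F yF] := dsum_supp dB y.
  exists (\sum_(k <- undup F) ja k (sval (cid (ex k)))).
  rewrite linear_sum [RHS](dsum_sumE dB (undup_uniq F) (x := y)); last first.
    by move=> k; rewrite mem_undup; exact: yF.
  by apply: eq_bigr => k _; rewrite fP /=; congr (jb k _); exact: svalP (cid (ex k)).
Qed.

Lemma projective_dsum (I : choiceType) (M : I -> lmodType L) D
    (j : forall k, {linear M k -> D}) (q : forall k, {linear D -> M k}) :
  is_dsum j q -> (forall k, projective (M k)) -> projective D.
Proof.
move=> dD Mp A B p g ps.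
have ex k := projective_lift (g \o j k : {linear M k -> B}) (Mp k) ps.
have [f fP] := dsum_lift dD (fun k => sval (cid (ex k))).
exists f; apply: (dsum_ext dD (f := p \o f)) => k x /=.
by rewrite fP; exact: svalP (cid (ex k)) x.
Qed.

Lemma pdle_dsum d (I : choiceType) (M : I -> lmodType L) D
    (j : forall k, {linear M k -> D}) (q : forall k, {linear D -> M k}) :
  is_dsum j q -> (forall k, pdle d (M k)) -> pdle d D.
Proof.
elim: d M D j q => [|d IH] M D j q dD Md; first exact: projective_dsum dD Md.
pose P k := sval (cid (Md k)); have PP k := svalP (cid (Md k)).
pose K k := sval (cid (PP k)); have KP k := svalP (cid (PP k)).
pose i k := sval (cid (KP k)); have iP k := svalP (cid (KP k)).
pose p k := sval (cid (iP k)).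
have pP k : [/\ projective (P k), ses (i k) (p k) & pdle d (K k)].
  exact: svalP (cid (iP k)).
have [DK [jk [qk dK]]] := exists_dsum K.
have [DP [jp [qp dP]]] := exists_dsum P.
have [|f [g [fg _ _]]] := dsum_ses (i := i) (p := p) dK dP dD.
  by move=> k; have [] := pP k.
exists DP, DK, f, g; split=> //.
  by apply: (projective_dsum dP) => k; have [] := pP k.
by apply: (IH _ _ _ _ dK) => k; have [] := pP k.
Qed.

End ProjectiveDimension.

(** * Vanishing of Ext and modules locally of finite projective dimension *)

Section Extensions.
Variable L : pzRingType.
Implicit Types A B C D E G H K M N P Q R S T U V W X Y Z : lmodType L.

(** Ext^1(Z, Y) = 0 in Yoneda's description, which dispenses with Ext groups. *)
Definition ext_vanish Z Y : Prop :=
  forall E (i : {linear Y -> E}) (p : {linear E -> Z}), ses i p ->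
    exists s : {linear Z -> E}, forall z, p (s z) = z.

Lemma ext_vanish_lift Z Y M N (i : {linear Y -> M}) (p : {linear M -> N})
    (g : {linear Z -> N}) : ext_vanish Z Y -> ses i p ->
  exists h : {linear Z -> M}, forall z, p (h z) = g z.
Proof.
move=> ZY ip; have [W [j [b [a [jb ab _ _]]]]] := pullback_ses g ip.
have [s sP] := ZY _ _ _ jb.
by exists (a \o s) => z; rewrite ab sP.
Qed.

Lemma ext_vanish_extend U V Z Y (i : {linear U -> V}) (p : {linear V -> Z})
    (f : {linear U -> Y}) : ext_vanish Z Y -> ses i p ->
  exists h : {linear V -> Y}, forall x, h (i x) = f x.
Proof.
move=> ZY ip; have [G [v [r [u [vr _ uv _]]]]] := pushout_ses f ip.
have [s sP] := ZY _ _ _ vr.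
have [t [tv _]] := ses_section_retraction vr sP.
by exists (t \o u) => x; rewrite /= uv tv.
Qed.

Lemma ext_vanish_retract U W Y : retract U W -> ext_vanish W Y -> ext_vanish U Y.
Proof.
move=> [s [r rs]] WY E i p ip; have [h hP] := ext_vanish_lift r WY ip.
by exists (h \o s) => u; rewrite hP.
Qed.

(** Dividing [E] by [A] leaves an extension of [Z] by [C], which splits; the splitting lifts back to
    [E] because the kernel of [E -> Q] is [A]. *)
Lemma ext_vanish_extr Z A B C (i : {linear A -> B}) (p : {linear B -> C}) :
  ses i p -> ext_vanish Z A -> ext_vanish Z C -> ext_vanish Z B.
Proof.
move=> ip ZA ZC E j q jq; have [ii ps e] := ip; have [ji qs qe] := jq.
have jii : injective (j \o i : {linear A -> E}) by move=> x y /ji /ii.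
have [Q [t [_ ts te]]] := ses_coker jii.
have [r rP] : exists r : {linear Q -> Z}, forall x, r (t x) = q x.
  by apply: factor_surj => // x /te [a <-]; exact: (ses0 jq).
have [l lP] : exists l : {linear C -> Q}, forall b, l (p b) = (t \o j) b.
  by apply: factor_surj => // b /e [a <-]; apply/te; exists a.
have lr : ses l r.
  split.
  - apply: lin_inj => c; have [b <-] := ps c; rewrite lP => /te [a /ji <-].
    exact: (ses0 ip).
  - by move=> z; have [x xz] := qs z; exists (t x); rewrite rP.
  - move=> y; have [x <-] := ts y; rewrite rP qe; split=> [[b <-]|[c]].
      by exists (p b).
    have [b <-] := ps c; rewrite lP /= => /eqP.
    rewrite eq_sym -subr_eq0 -linearB => /eqP/te [a ab].
    by exists (b + i a); rewrite linearD -[j (i a)]/((j \o i) a) ab addrC subrK.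
have [s sP] := ZC _ _ _ lr.
have ti : ses (j \o i) t by [].
have [h hP] := ext_vanish_lift s ZA ti.
by exists h => z; rewrite -rP hP sP.
Qed.

Lemma ext_vanish_extl Y A B C (i : {linear A -> B}) (p : {linear B -> C}) :
  ses i p -> ext_vanish A Y -> ext_vanish C Y -> ext_vanish B Y.
Proof.
move=> ip AY CY E j q jq; have [ii ps e] := ip; have [ji qs qe] := jq.
have [h hP] := ext_vanish_lift i AY jq.
have hi : injective h by move=> x y hxy; apply: ii; rewrite -!hP hxy.
have [Q [t [_ ts te]]] := ses_coker hi.
have [r rP] : exists r : {linear Q -> C}, forall x, r (t x) = (p \o q) x.
  by apply: factor_surj => // x /te [a <-]; rewrite /= hP; exact: (ses0 ip).
have tjr : ses (t \o j : {linear Y -> Q}) r.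
  split.
  - apply: lin_inj => y /te [a ay]; apply: (inj_eq0 ji).
    by rewrite -ay (inj_eq0 ii (x := a)) ?linear0 // -hP ay (ses0 jq).
  - move=> c; have [b <-] := ps c; have [x <-] := qs b.
    by exists (t x); rewrite rP.
  - move=> z; have [x <-] := ts z; rewrite rP; split=> [/e [a ax]|[y ty]].
      have /qe [y yx] : q (x - h a) = 0 by rewrite linearB /= hP ax subrr.
      exists y; rewrite /= yx linearB /=; have -> : t (h a) = 0 by apply/te; exists a.
      exact: subr0.
    by rewrite -rP -ty rP /= (ses0 jq) linear0.
have [s sP] := CY _ _ _ tjr.
(* [E] is the pullback of [B] and [Q] over [C], so a point of [E] is determined by its images under
   [q] and [t], and every compatible pair of images occurs. *)
have [f fP] : exists f : {linear B -> E}, forall b, q (f b) = b /\ t (f b) = s (p b).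
  apply: (lin_of_rel (R := fun b x => q x = b /\ t x = s (p b))).
  - by move=> a b b' x x' [<- tx] [<- tx']; rewrite !linearP tx tx'.
  - move=> b; have [x xs] := ts (s (p b)).
    have /e [a ab] : p (b - q x) = 0.
      by rewrite linearB /= -[p (q x)]rP xs sP subrr.
    exists (x + h a); rewrite !linearD hP ab addrC subrK xs; split=> //.
    have -> : t (h a) = 0 by apply/te; exists a.
    exact: addr0.
  - move=> x [qx]; rewrite !linear0 => /te [a ax].
    by rewrite -ax (inj_eq0 ii (x := a)) ?linear0 // -hP ax.
by exists f => b; have [] := fP b.
Qed.


Definition Pfin M : Prop := fin_gen M /\ exists d, pdle d M.

Definition locally_Pfin Z : Prop := forall N (g : {linear N -> Z}), fin_gen N ->
  exists A (j : {linear A -> Z}),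
    [/\ Pfin A, injective j & forall n, exists a, j a = g n].

(** Over a noetherian ring this says that [Z] is a direct limit of modules in [Pfin]. Without
    injectivity of [b] the property passes to retracts by mere composition, which [locally_Pfin]
    does not allow. *)
Definition factors_Pfin Z : Prop := forall N (g : {linear N -> Z}), fin_gen N ->
  exists A (a : {linear N -> A}) (b : {linear A -> Z}),
    Pfin A /\ forall n, b (a n) = g n.

Lemma Pfin_trivial Z : (forall z : Z, z = 0) -> Pfin Z.
Proof. by move=> Z0; split; [exact: fg_trivial | exists 0%N; exact: pdle_trivial]. Qed.

Lemma Pfin_ext A B C (i : {linear A -> B}) (p : {linear B -> C}) :
  ses i p -> Pfin A -> Pfin C -> Pfin B.
Proof.
move=> ip [Af [d Ad]] [Cf [e Ce]]; split; first exact: fg_ext ip Af Cf.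
exists (maxn d e); apply: (pdle_ext ip).
  exact: pdle_leq (leq_maxl _ _) Ad.
exact: pdle_leq (leq_maxr _ _) Ce.
Qed.

Lemma Pfin_coker A B C (i : {linear A -> B}) (p : {linear B -> C}) :
  ses i p -> Pfin A -> Pfin B -> Pfin C.
Proof.
move=> ip [Af [d Ad]] [Bf [e Be]].
split; first by apply: fg_surj Bf; case: ip => _ ps _; exact: ps.
exists (maxn d e).+1; apply: (pdle_coker ip).
  exact: pdle_leq (leq_maxl _ _) Ad.
exact: pdle_leq (leq_maxr _ _) Be.
Qed.

Lemma Pfin_retract U W : retract U W -> Pfin W -> Pfin U.
Proof.
move=> UW [Wf [d Wd]]; split; last by exists d; exact: pdle_retract UW Wd.
by case: UW => s [r rs]; apply: (fg_surj (p := r)) => // u; exists (s u).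
Qed.

Lemma Pfin_projective P : projective P -> fin_gen P -> Pfin P.
Proof. by move=> Pp Pf; split=> //; exists 0%N. Qed.

Lemma locally_factors Z : locally_Pfin Z -> factors_Pfin Z.
Proof.
move=> Zl N g Nf; have [A [j [Af ji jg]]] := Zl N g Nf.
have [a aP] : exists a : {linear N -> A}, forall n, j (a n) = g n.
  exact: factor_inj.
by exists A, a, j.
Qed.

Lemma factors_retract U W : retract U W -> factors_Pfin W -> factors_Pfin U.
Proof.
move=> [s [r rs]] Wf N g Nf.
have [A [a [b [Af ab]]]] := Wf N (s \o g) Nf.
by exists A, a, (r \o b); split=> // n; rewrite /= ab /= rs.
Qed.

Lemma factors_prod U V : factors_Pfin U -> factors_Pfin V ->
  factors_Pfin (U * V)%type.
Proof.
move=> Uf Vf N g Nf.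
have [A [a [b [Af ab]]]] := Uf N (@lfst L U V \o g) Nf.
have [C [c [d [Cf cd]]]] := Vf N (@lsnd L U V \o g) Nf.
exists (A * C)%type, (pairl a c).
exists (pairl (b \o @lfst L A C) (d \o @lsnd L A C)).
split=> [|n]; first exact: Pfin_ext (ses_prod A C) Af Cf.
by rewrite /= addr0 add0r ab cd /= addr0 add0r; case: (g n).
Qed.

(** * Permanence of the local and the factoring property over a noetherian ring *)

Section Noetherian.
Hypothesis noetherian : forall M N (i : {linear N -> M}),
  injective i -> fin_gen M -> fin_gen N.

Lemma fg_ker A B C (i : {linear A -> B}) (p : {linear B -> C}) :
  ses i p -> fin_gen B -> fin_gen A.
Proof. by move=> [ii _ _]; exact: (noetherian ii). Qed.

(** The submodule sought is the sum [V] of [A'] and the image of [R], where the finitely generated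
    [R] covers both [C'] and the image of [N]. Choosing [A'] large enough to contain the image of
    the kernel [H] of [R -> C'] makes [V] an extension of [C'] by [A']. *)
Lemma locally_ext A B C (i : {linear A -> B}) (p : {linear B -> C}) :
  ses i p -> locally_Pfin A -> locally_Pfin C -> locally_Pfin B.
Proof.
move=> ip Al Cl N g Nf; have [ii ps e] := ip.
have [C' [c [C'P ci cg]]] := Cl N (p \o g) Nf.
have [C'f _] := C'P.
have [R [k [Rf kP]]] : exists R (k : {linear R -> B}), fin_gen R /\
    (forall x, exists r, p (k r) = c x) /\ (forall n, exists r, k r = g n) /\
    forall r, exists x, p (k r) = c x.
  have [W [j [b [a [jb ab aj Wex]]]]] := pullback_ses c ip.
  have [_ bs _] := jb; have [V [h [Vf hP]]] := fg_lift bs C'f.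
  exists (V * N)%type, (copair (a \o h) g); split; first exact: fg_prod.
  split=> [x|]; first by have [v vx] := hP x; exists (v, 0); rewrite /= linear0 addr0 ab vx.
  split=> [n|[v n] /=]; first by exists (0, n); rewrite /= !linear0 add0r.
  by have [x xn] := cg n; exists (b (h v) + x); rewrite !linearD ab xn.
have [kc [kg ck]] := kP.
have [f fP] : exists f : {linear R -> C'}, forall r, c (f r) = (p \o k) r.
  by apply: factor_inj => // r; have [x xr] := ck r; exists x.
have fs : surj f by move=> x; have [r rx] := kc x; exists r; apply: ci; rewrite fP.
have [H [h hf]] := ses_ker fs; have [hi _ he] := hf.
have [l lP] : exists l : {linear H -> A}, forall x, i (l x) = (k \o h) x.
  by apply: factor_inj => // x; apply/e; rewrite -[LHS](fP (h x)) (ses0 hf) linear0.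
have [A' [j [A'P ji jl]]] := Al H l (fg_ker hf Rf).
pose q : {linear (A' * R)%type -> B} := copair (i \o j) k.
have [V [t [v [ts vi tv]]]] := image_factor q.
have tv' y r : v (t (y, r)) = i (j y) + k r by rewrite tv.
have [w wP] : exists w : {linear V -> C'}, forall x, w (t x) = (f \o @lsnd L A' R) x.
  apply: factor_surj => // -[y r] tyr; rewrite /= add0r; apply: ci.
  rewrite fP linear0; have := congr1 (p \o v) tyr.
  by rewrite /= tv' linear0 linearD (ses0 ip) add0r linear0.
have w' y r : w (t (y, r)) = f r by rewrite wP /= add0r.
have tw : ses (t \o linl A' R : {linear A' -> V}) w.
  split.
  - move=> y z ty; apply: ji; apply: ii.
    have := congr1 v ty; by rewrite /= !tv' linear0 !addr0.
  - by move=> x; have [r <-] := fs x; exists (t (0, r)); rewrite w'.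
  - move=> x; have [[y r] <-] := ts x; rewrite w'; split=> [/he [z zr]|[z]].
      have [u uz] := jl z; exists (y + u); apply: vi.
      by change (v (t (y + u, 0)) = v (t (y, r))); rewrite !tv' !linearD linear0 addr0 uz lP /= zr.
    move=> /(congr1 w); change (w (t (z, 0)) = w (t (y, r)) -> f r = 0).
    by rewrite !w' linear0 => <-.
exists V, v; split=> //; first exact: Pfin_ext tw A'P C'P.
by move=> n; have [r <-] := kg n; exists (t (0, r)); rewrite tv' !linear0 add0r.
Qed.

Lemma locally_dsum (I : choiceType) (M : I -> lmodType L) D
    (j : forall k, {linear M k -> D}) (q : forall k, {linear D -> M k}) :
  is_dsum j q -> (forall k, Pfin (M k)) -> locally_Pfin D.
Proof.
move=> dD Mf N g Nf; have [F [uF FP]] := dsum_fg_supp dD g Nf.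
have [A [l [Af li lP]]] := dsum_partial dD Pfin_trivial Pfin_ext Mf F.
by exists A, l; split=> // n; apply/lP => i; exact: FP.
Qed.

Lemma factors_projective P : projective P -> factors_Pfin P.
Proof.
move=> Pp; have [D [j [q dD]]] := exists_dsum (fun _ : P => L^o).
have [h hP] := dsum_lift dD (fun z => mulby z).
have hs : surj h by move=> z; exists (j z 1); rewrite hP /= scale1r.
have [s sP] := projective_lift (lid P) Pp hs.
apply: (factors_retract (W := D)); first by exists s, h.
apply: locally_factors; apply: (locally_dsum dD) => _.
by apply: Pfin_projective; [exact: projective_regular | exact: fg_regular].
Qed.

(** A presentation [K -> P -> N] maps to [A -> B -> Z], and [K] lands in some [A'] inside [A]. The
    pushout [G] of [P] and [A'] is finitely generated, so its map to [B] factors through some [A''].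
    As [A' -> A'' -> B] is injective, so is [A' -> A'']; hence [A'' / A'] lies in [Pfin], and [g]
    factors through it. *)
Lemma factors_coker A B Z (i : {linear A -> B}) (p : {linear B -> Z}) :
  ses i p -> locally_Pfin A -> factors_Pfin B -> factors_Pfin Z.
Proof.
move=> ip Al Bf N g Nf; have [ii ps e] := ip.
have [P [q [Pp Pf qs]]] := fg_cover Nf.
have [K [k kq]] := ses_ker qs; have [ki _ ke] := kq.
have [l lP] := projective_lift (g \o q : {linear P -> Z}) Pp ps.
have [m mP] : exists m : {linear K -> A}, forall x, i (m x) = (l \o k) x.
  by apply: factor_inj => // x; apply/e; rewrite /= lP /= (ses0 kq) linear0.
have [A' [j [A'P ji jm]]] := Al K m (fg_ker kq Pf).
have [n nP] : exists n : {linear K -> A'}, forall x, j (n x) = m x.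
  exact: factor_inj.
have [G [v [r [u [vr ru uv gen]]]]] := pushout_ses n kq.
have [vi _ ve] := vr.
have Gf : fin_gen G.
  apply: (@fg_surj _ _ _ (copair u v)); last exact: fg_prod Pf A'P.1.
  by move=> x; have [b [c ->]] := gen x; exists (b, c).
have [f fP] : exists f : {linear G -> B}, forall x, f (copair u v x) = copair l (i \o j) x.
  apply: factor_surj => [x|[b c] /= bc].
    by have [b [c ->]] := gen x; exists (b, c).
  have /ke [x xb] : q b = 0.
    by have := congr1 r bc; rewrite linearD ru (ses0 vr) addr0 linear0.
  have : v (n x + c) = 0 by rewrite linearD -uv xb.
  by move=> /(inj_eq0 vi) nc; rewrite -xb -[l (k x)]mP -nP -!linearD nc !linear0.
have fu b : f (u b) = l b by have := fP (b, 0); rewrite /= !linear0 !addr0.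
have fv c : f (v c) = i (j c) by have := fP (0, c); rewrite /= !linear0 !add0r.
have [A'' [a [b [A''P ab]]]] := Bf G f Gf.
have avi : injective (a \o v : {linear A' -> A''}).
  by move=> x y /(congr1 b) /=; rewrite !ab !fv => /ii /ji.
have [Q [t tq]] := ses_coker avi; have [_ ts te] := tq.
have [z zP] : exists z : {linear Q -> Z}, forall x, z (t x) = (p \o b) x.
  by apply: factor_surj => // x /te [y <-]; rewrite /= ab fv (ses0 ip).
have [y yP] : exists y : {linear N -> Q}, forall x, y (q x) = (t \o a \o u) x.
  apply: factor_surj => // x /ke [c <-]; apply/te; exists (n c).
  by rewrite /= uv.
exists Q, y, z; split; first exact: Pfin_coker tq A'P A''P.
by move=> x; have [c <-] := qs x; rewrite yP zP /= ab fu lP.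
Qed.

End Noetherian.

End Extensions.

(** * Splitting of pure extensions *)

Section PureInjectivity.
Variable L : pzRingType.
Implicit Types A B C D E M N P Q R S V W X Y Z : lmodType L.

(* The subgroups { h x | h : N -> Y } for pointed finitely generated (N, x) are
   the matrix subgroups (subgroups of finite definition) of Y; a module with
   the descending chain condition on them is Sigma-pure-injective. *)
Definition dcc_matrix_subgroups Y : Prop :=
  forall T : (forall N, N -> Prop),
    (exists N x, T N x) -> (forall N x, T N x -> fin_gen N) ->
  exists N (x : N), T N x /\ forall N' x' (f : {linear N -> N'}),
    T N' x' -> f x = x' ->
    forall h : {linear N -> Y}, exists h' : {linear N' -> Y}, h' x' = h x.

(** * Zorn's lemma on partial retractions of a pure embedding *)

Section PureExtension.
Hypothesis noetherian : forall M N (i : {linear N -> M}),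
  injective i -> fin_gen M -> fin_gen N.
Variables (E Y : lmodType L).
Implicit Types G H K : set (E * Y).

Definition graph_linear (G : set (E * Y)) : Prop :=
  forall a x y x' y', G (x, y) -> G (x', y') -> G (a *: x + x', a *: y + y').

(* Every finitely generated module sees G as a partial map that extends; in
   particular G is functional. *)
Definition locally_extends (G : set (E * Y)) : Prop :=
  forall N (g : {linear N -> E}), fin_gen N ->
    exists h : {linear N -> Y}, forall m y, G (g m, y) -> h m = y.

Lemma locally_extends_fun G x y y' : graph_linear G -> locally_extends G ->
  G (x, y) -> G (x, y') -> y = y'.
Proof.
move=> _ /(_ _ (mulby x) (@fg_regular L)) [h hP] Gy Gy'.
have h1 z : G (x, z) -> h 1 = z by move=> Gz; apply: hP; rewrite /= scale1r.
by rewrite -(h1 _ Gy) -(h1 _ Gy').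
Qed.

Lemma graph_dom_submod N (g : {linear N -> E}) G : graph_linear G -> G (0, 0) ->
  submod (fun m => exists y, G (g m, y)).
Proof.
move=> Gl G0; split; first by exists 0; rewrite linear0.
by move=> a x x' [y Gy] [y' Gy']; exists (a *: y + y'); rewrite linearP; exact: Gl.
Qed.

Lemma locally_extends_chain (F : set (set (E * Y))) :
    (forall G, F G -> [/\ G (0, 0), graph_linear G & locally_extends G]) ->
    total_on F subset -> (exists G, F G) ->
  let U := (\bigcup_(G in F) G)%classic in
  [/\ U (0, 0), graph_linear U & locally_extends U].
Proof.
move=> FP Ftot [G0 FG0] U.
have max2 G H : F G -> F H -> exists2 K, F K & (G `<=` K /\ H `<=` K)%classic.
  by move=> FG FH; case: (Ftot _ _ FG FH) => GH; [exists H | exists G] => //; split.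
have Ul : graph_linear U.
  move=> a x y x' y' [G FG Gy] [H FH Hy].
  have [K FK [GK HK]] := max2 G H FG FH.
  by exists K => //; have [_ Kl _] := FP K FK; apply: Kl; [exact: GK | exact: HK].
have U0 : U (0, 0) by exists G0 => //; have [] := FP _ FG0.
split=> // N g Nf.
have [D [d [di dP]]] := exists_sub (graph_dom_submod g Ul U0).
have /fin_genP [w wP] := noetherian di Nf.
(* The part of [N] sent into the domain of the union is finitely generated, so a single member of
   the chain is already defined on it. *)
have [G FG Gw] : exists2 G, F G & forall s, s \in w -> exists y, G (g (d s), y).
  elim: {wP} w => [|s w [G FG Gw]]; first by exists G0.
  have /dP [y [H FH Hy]] : exists t, d t = d s by exists s.
  have [K FK [GK HK]] := max2 G H FG FH; exists K => // t.
  rewrite inE => /predU1P[->|/Gw [z Gz]]; first by exists y; exact: HK.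
  by exists z; exact: GK.
have [G00 Gl Ge] := FP G FG; have [h hP] := Ge N g Nf.
exists h => m y Uy; have /dP [s sm] : exists y, U (g m, y) by exists y.
have [z Gz] : exists z, G (g m, z).
  rewrite -sm; apply: (lspan_ind (U := fun s => exists z, G (g (d s), z)) _ Gw) (wP s).
  exact: (graph_dom_submod (g \o d) Gl G00).
rewrite (hP _ _ Gz); case: Uy => H FH Hy.
have [K FK [GK HK]] := max2 G H FG FH; have [_ Kl Ke] := FP K FK.
exact: (locally_extends_fun Kl Ke (GK _ Gz) (HK _ Hy)).
Qed.

(** The values at [m] of the maps [M -> Y] extending [G] form a coset of the matrix subgroup of
    [(N, n)], where [N] is [M] modulo the part sent into the domain of [G] and [n] is the class of
    [m]. A pair with minimal subgroup has its coset contained in the coset of any other pair, as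
    comparison inside [M * M'] shows; any value from that coset will do. *)
Lemma locally_extends_step (G : set (E * Y)) x : dcc_matrix_subgroups Y ->
    G (0, 0) -> graph_linear G -> locally_extends G ->
  exists y, forall M (g : {linear M -> E}) m, fin_gen M -> g m = x ->
    exists h : {linear M -> Y}, (forall u z, G (g u, z) -> h u = z) /\ h m = y.
Proof.
move=> Ydcc G0 Gl Ge.
pose dom_ker M N (g : {linear M -> E}) (q : {linear M -> N}) :=
  surj q /\ forall u, q u = 0 <-> exists z, G (g u, z).
have ex_quo M (g : {linear M -> E}) : exists N (q : {linear M -> N}), dom_ker M N g q.
  by have [N [q [qs qP]]] := exists_quo (graph_dom_submod g Gl G0); exists N, q.
pose T N (n : N) := fin_gen N /\ exists M (g : {linear M -> E}) m (q : {linear M -> N}),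
  [/\ fin_gen M, g m = x, dom_ker M N g q & q m = n].
have [|N n [Nf _] //|N [n [[Nf [M [g [m [q [Mf gm [qs qk] qm]]]]]] Nmin]]] := Ydcc T.
  have [N [q qP]] := ex_quo _ (mulby x); exists N, (q 1); split.
    exact: fg_surj qP.1 (@fg_regular L).
  by exists L^o, (mulby x), 1, q; split=> //=; [exact: fg_regular | rewrite scale1r].
have [h0 h0P] := Ge M g Mf; exists (h0 m) => M' g' m' M'f g'm'.
have [h2 h2P] := Ge _ (copair g g') (fg_prod Mf M'f).
have [N2 [q2 [q2s q2k]]] := ex_quo _ (copair g g').
have T2 : T N2 (q2 (m, 0)).
  split; first exact: fg_surj q2s (fg_prod Mf M'f).
  exists (M * M')%type, (copair g g'), (m, 0), q2; split=> //.
    exact: fg_prod.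
  by rewrite /= linear0 addr0.
have [f fP] : exists f : {linear N -> N2}, forall u, f (q u) = (q2 \o linl M M') u.
  apply: factor_surj => // u /qk [z Gz]; apply/q2k; exists z.
  by rewrite /= linear0 addr0.
(* The difference of two extensions on [M] kills the domain of [G], hence factors through [N]. By
   minimality its value at [n] is also attained by some [e] on [N2], and [h2] corrected by [e] takes
   the value [h0 m]. *)
have [d dP] : exists d : {linear N -> Y}, forall u, d (q u) = lsub h0 (h2 \o linl M M') u.
  apply: factor_surj => // u /qk [z Gz]; rewrite /= (h0P _ _ Gz) (h2P _ z) ?subrr //.
  by rewrite /= linear0 addr0.
have fn : f n = q2 (m, 0) by rewrite -qm fP.
have [e eP] := Nmin _ _ f T2 fn d.
(* As [m] and [m'] both lie over [x], their difference lies over 0, where [G] takes the value 0; so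
   [h2] and [q2] cannot tell [(m, 0)] from [(0, m')]. *)
have m20 : copair g g' (m, - m') = 0 by rewrite /= linearN gm g'm' subrr.
have mm' : (m, 0) = (m, - m') + (0, m') :> M * M'.
  by congr (_, _); rewrite ?addr0 ?addNr.
exists (copair h2 (e \o q2) \o pairl (linr M M') (linr M M')).
split=> [u z Gz|].
  have gu : copair g g' (0, u) = g' u by rewrite /= linear0 add0r.
  rewrite -[LHS]/(h2 (0, u) + e (q2 (0, u))).
  have -> : q2 (0, u) = 0 by apply/q2k; exists z; rewrite gu.
  by rewrite linear0 addr0; apply: h2P; rewrite gu.
have h2m : h2 (m, 0) = h2 (0, m').
  have h20 : h2 (m, - m') = 0 by apply: h2P; rewrite m20.
  by rewrite mm' linearD h20 add0r.
have q2m : q2 (m, 0) = q2 (0, m').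
  have q20 : q2 (m, - m') = 0 by apply/q2k; exists 0; rewrite m20.
  by rewrite mm' linearD q20 add0r.
rewrite -[LHS]/(h2 (0, m') + e (q2 (0, m'))) -h2m -q2m eP -qm dP.
by rewrite -[lsub _ _ _]/(h0 m - h2 (m, 0)) addrC subrK.
Qed.

Lemma locally_extends_retraction (i : {linear Y -> E}) : dcc_matrix_subgroups Y ->
    locally_extends (fun xy => xy.1 = i xy.2) ->
  exists r : {linear E -> Y}, forall y, r (i y) = y.
Proof.
move=> Ydcc i_ext.
pose G0 : set (E * Y) := fun xy => xy.1 = i xy.2.
have G0l : graph_linear G0 by move=> a x y x' y'; rewrite /G0 /= linearP => -> ->.
have G00 : G0 (0, 0) by rewrite /G0 /= linear0.
pose good (G : set (E * Y)) := [/\ (G0 `<=` G)%classic, graph_linear G & locally_extends G].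
have good0 : good G0 by split.
have [|G [GP Gmax]] := @Zorn_bigcup (E * Y)%type (fun G => G = set0 \/ good G).
  move=> F FP Ftot; have [[G [FG GP]]|none] := pselect (exists G, F G /\ good G).
    right; pose F' := fun H => F H /\ good H.
    have -> : (\bigcup_(H in F) H = \bigcup_(H in F') H)%classic.
      apply/seteqP; split=> z [H FH Hz]; last by exists H => //; case: FH.
      by exists H => //; split=> //; case: (FP H FH) => // H0; rewrite H0 in Hz.
    have [||_ Ul Ue] := @locally_extends_chain F' _ _ (ex_intro _ G (conj FG GP)).
    - by move=> H [_ [HG Hl He]]; split=> //; exact: HG.
    - by move=> H K [FH _] [FK _]; exact: Ftot.
    - split=> // z G0z; have [GG _ _] := GP.
      by exists G; [split | exact: GG].
  left; apply/seteqP; split=> // z [H FH Hz]; case: (FP H FH) => [H0|Hg].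
    by rewrite H0 in Hz.
  by case: none; exists H.
have [GG Gl Ge] : good G.
  case: GP => // GE; case: (Gmax G0 _); last by right.
  rewrite GE; split=> // /(_ (0, 0) G00) //.
have Gdom x : exists y, G (x, y).
  have [y yP] := locally_extends_step x Ydcc (GG _ G00) Gl Ge.
  pose G1 : set (E * Y) := fun z => exists a u v,
    [/\ G (u, v) & z = (u + a *: x, v + a *: y)].
  have GG1 : (G `<=` G1)%classic.
    by move=> [u v] Guv; exists 0, u, v; rewrite !scale0r !addr0.
  have G1x : G1 (x, y).
    by exists 1, 0, 0; split; [exact: GG | rewrite !scale1r !add0r].
  suff G1g : good G1.
    apply: contrapT => nx; case: (Gmax G1); last by right.
    split=> // /(_ (x, y) G1x) Gxy; apply: nx; by exists y.
  split; first by move=> z /GG /GG1.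
    move=> a _ _ _ _ [b [u [v [Guv [-> ->]]]]] [b' [u' [v' [Guv' [-> ->]]]]].
    exists (a * b + b'), (a *: u + u'), (a *: v + v'); split; first exact: Gl.
    by rewrite !scalerDr !scalerA !scalerDl; congr (_, _); exact: addrACA.
  move=> N g Nf.
  (* Adjoining a free generator over [x] to [N] makes the choice of [y] apply: [(m, - a)] lies over
     [u], and the generator has value [y]. *)
  have [|h [hG h1]] := yP _ (copair g (mulby x)) (0, 1) (fg_prod Nf (@fg_regular L)).
    by rewrite /= linear0 add0r scale1r.
  exists (h \o linl N L^o) => m z [a [u [v [Guv [gm ->]]]]].
  have ghu : copair g (mulby x) (m, - a) = u by rewrite /= gm scaleNr addrK.
  have := hG (m, - a) v; rewrite ghu => /(_ Guv) <-.
  have -> : (m, - a : L^o) = linl N L^o m - a *: (0, 1 : L^o).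
    congr (_, _); rewrite /= ?scaler0 ?subr0 // sub0r; congr (- _).
    exact/esym/mulr1.
  by rewrite linearB linearZ /= h1 subrK.
have [r rP] : exists r : {linear E -> Y}, forall x, G (x, r x).
  apply: (lin_of_rel (R := fun x y => G (x, y))) => //.
    by move=> a x x' y y'; exact: Gl.
  move=> y Gy; apply: (locally_extends_fun Gl Ge Gy); exact: GG.
exists r => y; apply: (locally_extends_fun Gl Ge (rP (i y))); exact: GG.
Qed.

End PureExtension.

(** Maps from finitely generated modules to [W] lift to [E], since they factor through some [A] over
    which the extension splits. Thus [Y] is pure in [E], and the chain condition provides a
    retraction. *)
Lemma ext_vanish_factors W Y :
    (forall M N (i : {linear N -> M}), injective i -> fin_gen M -> fin_gen N) ->
    dcc_matrix_subgroups Y -> (forall A, Pfin A -> ext_vanish A Y) ->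
  factors_Pfin W -> ext_vanish W Y.
Proof.
move=> noeth Ydcc PY Wf E i p ip; have [ii ps e] := ip.
have [|r rP] := locally_extends_retraction noeth Ydcc (i := i).
  (* Factoring the image [V] instead of [N] ensures that the lift vanishes on the elements of [N]
     sent into [Y], so that [h] agrees there with [g]. *)
  move=> N g Nf; have [V [q [v [qs vi qv]]]] := image_factor (p \o g).
  have [A [a [b [AP ab]]]] := Wf V v (fg_surj qs Nf).
  have [b' b'P] := ext_vanish_lift b (PY A AP) ip.
  have [h hP] : exists h : {linear N -> Y},
      forall n, i (h n) = lsub g (b' \o a \o q) n.
    apply: factor_inj => // n; apply/e.
    by rewrite /= linearB /= b'P ab qv subrr.
  exists h => m y /= gm; have qm : q m = 0.
    by apply: (inj_eq0 vi); rewrite qv /= gm (ses0 ip).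
  by apply: ii; rewrite hP /= gm qm !linear0 addr0.
exact: ses_retraction_section ip rP.
Qed.

End PureInjectivity.

(** * Chain conditions over an Artin algebra *)

Lemma artinian_min (k : comPzRingType) : artinian k ->
  forall F : (k^o -> Prop) -> Prop, (exists I, F I) -> (forall I, F I -> submod I) ->
  exists I, F I /\ forall J, F J -> (forall x, J x -> I x) -> forall x, I x -> J x.
Proof.
move=> kart F [I0 FI0] Fsub; apply: contrapT => nomin.
have next (I : {I | F I}) : exists J : {I | F I},
    (forall x, sval J x -> sval I x) /\ ~ (forall x, sval I x -> sval J x).
  apply: contrapT => nex; apply: nomin; exists (sval I); split; first exact: svalP.
  move=> J FJ JI; apply: contrapT => IJ; apply: nex; by exists (exist _ J FJ).
have [f fP] := choice next.
pose I n := iter n f (exist _ I0 FI0).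
have [||m mP] := kart (fun n x => `[< sval (I n) x >]).
- move=> n; have [U0 Ul] := Fsub _ (svalP (I n)).
  by split=> [|a x y /asboolP Ux /asboolP Uy]; apply/asboolP => //; exact: Ul.
- by move=> n x /asboolP Ix; apply/asboolP; apply: (fP (I n)).1.
- case: (fP (I m)) => _; apply=> x Ix; have := mP m.+1 (leqnSn m) x.
  by rewrite !unfold_in => E; apply/asboolP; rewrite -[`[< _ >]]/(`[< sval (I m.+1) x >]) E; apply/asboolP.
Qed.

Section ArtinAlgebra.
Variables (L : pzRingType) (k : comPzRingType) (phi : {rmorphism k -> L}).
Hypothesis kart : artinian k.
Hypothesis kcentral : forall (a : k) (x : L), phi a * x = x * phi a.
Hypothesis kfin : exists (n : nat) (s : 'I_n -> L), forall x : L,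
  exists c : 'I_n -> k, x = \sum_(i < n) phi (c i) * s i.
Implicit Types A B C D E H M N P Q R S W X Y Z : lmodType L.

Definition ksub M (U : M -> Prop) : Prop :=
  U 0 /\ forall a x y, U x -> U y -> U (phi a *: x + y).

Lemma kspan_ksub M (w : seq M) : ksub (lspan phi w).
Proof.
elim: w => [|s w [IH0 IHl]] /=.
  by split=> // a x y -> ->; rewrite scaler0 addr0.
split; first by exists 0, 0; split=> //; rewrite rmorph0 scale0r addr0.
move=> a _ _ [b [x [wx ->]]] [c [y [wy ->]]].
exists (a * b + c), (phi a *: x + y); split; first exact: IHl.
by rewrite scalerDr scalerA -rmorphM rmorphD scalerDl addrACA.
Qed.

Lemma kspan_mem M (w : seq M) s : s \in w -> lspan phi w s.
Proof.
elim: w => [|t w IH] //; rewrite inE => /predU1P[->|/IH sw] /=.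
  exists 1, 0; rewrite rmorph1 scale1r addr0; split=> //.
  by case: (kspan_ksub w).
by exists 0, s; rewrite rmorph0 scale0r add0r.
Qed.

Lemma fin_gen_kspan M : fin_gen M -> exists w : seq M, forall x, lspan phi w x.
Proof.
move=> [n [s sP]]; have [m [t tP]] := kfin.
exists [seq t j *: s i | j <- enum 'I_m, i <- enum 'I_n] => x.
have [U0 Ul] := kspan_ksub [seq t j *: s i | j <- enum 'I_m, i <- enum 'I_n].
have [c ->] := sP x.
elim/big_ind: _ => // [y z yw zw|i _].
  by rewrite -[y]scale1r -(rmorph1 phi); exact: Ul.
have [d ->] := tP (c i); rewrite scaler_suml.
elim/big_ind: _ => // [y z yw zw|j _].
  by rewrite -[y]scale1r -(rmorph1 phi); exact: Ul.
rewrite -scalerA -[_ *: _]addr0; apply: Ul => //; apply: kspan_mem.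
by apply/allpairsP; exists (j, i); rewrite !mem_enum.
Qed.

Lemma ksub_min M : fin_gen M -> forall F : (M -> Prop) -> Prop,
    (exists U, F U) -> (forall U, F U -> ksub U) ->
  exists U, F U /\ forall V, F V -> (forall x, V x -> U x) -> forall x, U x -> V x.
Proof.
move=> /fin_gen_kspan[w wP] F Fex Fsub.
(* For induction on the spanning list, minimality is required only of the trace on the span of
   [w]. *)
suff [U [FU UP]] : exists U, F U /\ forall V, F V -> (forall x, V x -> U x) ->
    forall x, lspan phi w x -> U x -> V x.
  by exists U; split=> // V FV VU x; exact: UP.
elim: {wP} w F Fex Fsub => [|s w IH] F Fex Fsub.
  case: Fex => U FU; exists U; split=> // V FV _ x -> _.
  by case: (Fsub V FV).
have [U0 [FU0 U0P]] := IH F Fex Fsub.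
pose F' U := F U /\ forall x, U x -> U0 x.
(* U is determined by its trace on the span of w and by the ideal of the
   coefficients of s in it; the latter is minimized second. *)
pose I U (a : k^o) := exists y, lspan phi w y /\ U (phi a *: s + y).
have [w0 wl] := kspan_ksub w.
have [||J [[U [[FU UU0] ->]] Jmin]] :=
  @artinian_min k kart (fun J => exists U, F' U /\ J = I U).
- by exists (I U0), U0; split.
- move=> _ [U [[/Fsub[V0 Vl] _] ->]]; split.
    by exists 0; rewrite rmorph0 scale0r addr0.
  move=> a b c [x [wx Ux]] [y [wy Uy]]; exists (phi a *: x + y); split; first exact: wl.
  rewrite rmorphD rmorphM scalerDl -scalerA addrACA -scalerDr; exact: Vl.
exists U; split=> // V FV VU _ [a [y [wy ->]]] Uay.
have F'V : F' V by split=> // x /VU /UU0.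
have [||y' [wy' Vay']] := Jmin (I V) (ex_intro _ V (conj F'V erefl)) _ a.
- by move=> b [z [wz Vz]]; exists z; split=> //; exact: VU.
- by exists y.
have [V0 Vl] := Fsub V FV; have [_ U0l] := Fsub U0 FU0.
have -> : phi a *: s + y = phi 1 *: (phi a *: s + y') + (y - y').
  by rewrite rmorph1 scale1r addrACA subrr addr0.
have N1 x z : x - z = phi (-1) *: z + x.
  by rewrite rmorphN rmorph1 scaleN1r addrC.
apply: Vl => //; apply: (U0P V FV); first by move=> x /VU /UU0.
  by rewrite N1; exact: wl.
have -> : y - y' = phi (-1) *: (phi a *: s + y') + (phi a *: s + y).
  by rewrite -N1 opprD addrACA subrr add0r.
by apply: U0l; apply: UU0 => //; exact: VU.
Qed.

Lemma submod_min M : fin_gen M -> forall F : (M -> Prop) -> Prop,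
    (exists U, F U) -> (forall U, F U -> submod U) ->
  exists U, F U /\ forall V, F V -> (forall x, V x -> U x) -> forall x, U x -> V x.
Proof.
move=> Mf F Fex Fsub; apply: ksub_min => // U /Fsub[U0 Ul]; split=> // a; exact: Ul.
Qed.

(** Centrality of [phi] makes this [L]-linear. It is the reason why matrix subgroups are
    [k]-submodules, although they need not be [L]-submodules. *)
Definition kscale M Y (a : k) (h : {linear M -> Y}) : {linear M -> Y}.
Proof.
unshelve refine (@mklin L M Y (fun x => phi a *: h x) _).
by move=> b x y; rewrite linearP scalerDr !scalerA kcentral.
Defined.

(** However large [I] is, only [n] different summands occur. The matrix subgroups of all [K j] at
    [(N, x)] are packed into one [k]-submodule [U N x] of the finite direct sum [V], and a minimal
    [U N x] is minimal for every [K j] at once. *)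
Lemma dcc_matrix_dsum n (K : 'I_n -> lmodType L) (I : choiceType)
    (sigma : I -> 'I_n) Y
    (inj : forall i, {linear K (sigma i) -> Y}) (pr : forall i, {linear Y -> K (sigma i)}) :
  (forall j, fin_gen (K j)) -> is_dsum inj pr -> dcc_matrix_subgroups Y.
Proof.
move=> Kf dY T [N0 [x0 T0]] Tf.
have [V [jV [qV dV]]] := exists_dsum K.
have Vf : fin_gen V.
  have [A [l [Af li lP]]] := dsum_partial dV (@fg_trivial L) (@fg_ext L) Kf (enum 'I_n).
  apply: fg_surj Af => v; apply/lP => i; by rewrite mem_enum.
pose U N (x : N) (v : V) := forall j, exists h : {linear N -> K j}, h x = qV j v.
have [||_ [[N [x [TN ->]]] Nmin]] :=
  ksub_min Vf (F := fun J : V -> Prop => exists N (x : N), T N x /\ J = U N x).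
- by exists (U N0 x0), N0, x0.
- move=> _ [N [x [_ ->]]]; split=> [j|a v v' Uv Uv' j].
    by exists (lzero N (K j)); rewrite linear0.
  have [h hx] := Uv j; have [h' hx'] := Uv' j.
  exists (lsub h' (kscale (- a) h)).
  by rewrite linearP -hx -hx' /= rmorphN scaleNr opprK addrC.
exists N, x; split=> // N' x' f TN' fx h.
have NN' j (g : {linear N -> K j}) : exists g' : {linear N' -> K j}, g' x' = g x.
  have UN' : exists M (y : M), T M y /\ U N' x' = U M y by exists N', x'.
  have UN v : U N' x' v -> U N x v.
    by move=> Uv i; have [e ex] := Uv i; exists (e \o f); rewrite /= fx ex.
  have [i|g' g'x] := Nmin _ UN' UN (jV j (g x)) _ j.
    have [<-|ji] := eqVneq j i; first by exists g; rewrite (dsum_prK dV).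
    by exists (lzero N (K i)); rewrite (dsum_pr0 dV).
  by exists g'; rewrite g'x (dsum_prK dV).
have ex i := NN' (sigma i) (pr i \o h).
have [F xF] := dsum_supp dY (h x).
(* Only the value [h x] has to be matched, not [h] itself, so a sum over the finite support of [h x]
   is enough. *)
exists (lsum (undup F) (fun i => inj i \o sval (cid (ex i)))).
rewrite [RHS](dsum_sumE dY (undup_uniq F)); last first.
  by move=> i; rewrite mem_undup; exact: xF.
by apply: eq_bigr => i _; rewrite /= (svalP (cid (ex i))).
Qed.

End ArtinAlgebra.

(** * The Jacobson radical of an Artinian ring *)

Section ArtinianRing.
Variable L : pzRingType.
Implicit Types M N P Q R V W X Y Z : lmodType L.

Definition submod_dcc M : Prop := forall F : (M -> Prop) -> Prop,
  (exists U, F U) -> (forall U, F U -> submod U) ->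
  exists U, F U /\ forall U', F U' -> (forall x, U' x -> U x) -> forall x, U x -> U' x.

Lemma submod_dcc_inj N M (i : {linear N -> M}) :
  injective i -> submod_dcc M -> submod_dcc N.
Proof.
move=> ii Md F [U0 FU0] Fsub.
pose im (U : N -> Prop) x := exists u, U u /\ i u = x.
have imP U u : im U (i u) -> U u by move=> [u' [Uu /ii <-]].
have [||_ [[U [FU ->]] Umin]] := Md (fun J => exists U, F U /\ J = im U).
- by exists (im U0), U0.
- move=> _ [U [/Fsub[U00 Ul] ->]]; split; first by exists 0; rewrite linear0.
  move=> a _ _ [u [Uu <-]] [u' [Uu' <-]]; exists (a *: u + u').
  by rewrite linearP; split=> //; exact: Ul.
exists U; split=> // U' FU' U'U x Ux; apply: imP.
apply: (Umin (im U')); first by exists U'.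
  by move=> _ [u [/U'U Uu <-]]; exists u.
by exists x.
Qed.

Lemma submod_dcc_surj M N (p : {linear M -> N}) :
  surj p -> submod_dcc M -> submod_dcc N.
Proof.
move=> ps Md F [U0 FU0] Fsub.
have [||_ [[U [FU ->]] Umin]] := Md (fun J => exists U, F U /\ J = U \o p).
- by exists (U0 \o p), U0.
- move=> _ [U [/Fsub[U00 Ul] ->]]; split; first by rewrite /= linear0.
  by move=> a x y /= Ux Uy; rewrite linearP; exact: Ul.
exists U; split=> // U' FU' U'U y; have [x <-] := ps y.
by apply: (Umin (U' \o p)); [exists U' | move=> z; exact: U'U].
Qed.

Hypothesis fg_dcc : forall M, fin_gen M -> submod_dcc M.

Definition maxideal (m : L^o -> Prop) : Prop :=
  [/\ submod m, ~ m 1 & forall U, submod U -> (forall x, m x -> U x) -> ~ U 1 ->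
    forall x, U x -> m x].

Definition jac (x : L^o) : Prop := forall m, maxideal m -> m x.

Lemma exists_maxideal (I : L^o -> Prop) : submod I -> ~ I 1 ->
  exists m, maxideal m /\ forall x, I x -> m x.
Proof.
move=> Isub I1.
pose proper (A : set L^o) := [/\ submod A, forall x, I x -> A x & ~ A 1].
have [|A [AP Amax]] := @Zorn_bigcup L^o (fun A => A = set0 \/ proper A).
  move=> F FP Ftot; have [[A [FA Ap]]|none] := pselect (exists A, F A /\ proper A).
    have [[A0 Al] IA A1] := Ap.
    right; split.
    - split=> [|a x y [B FB Bx] [C FC Cy]]; first by exists A.
      have [D FD [BD CD]] : exists2 D, F D & (B `<=` D /\ C `<=` D)%classic.
        by case: (Ftot _ _ FB FC) => BC; [exists C | exists B] => //; split.
      case: (FP D FD) => [D0|[[_ Dl] _ _]]; first by move: (BD _ Bx); rewrite D0.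
      by exists D => //; apply: Dl; [exact: BD | exact: CD].
    - by move=> x Ix; exists A => //; exact: IA.
    - move=> [B FB B1]; case: (FP B FB) => [B0|[_ _]]; last by apply.
      by rewrite B0 in B1.
  left; apply/seteqP; split=> // z [B FB Bz]; case: (FP B FB) => [B0|Bp].
    by rewrite B0 in Bz.
  by case: none; exists B.
have [Asub IA A1] : proper A.
  case: AP => // AE; case: (Amax I _); last by right; split.
  by rewrite AE; split=> // /(_ 0 Isub.1).
exists A; split=> //; split=> // U Usub AU U1 x Ux; apply: contrapT => nAx.
case: (Amax U); first by split=> // /(_ x Ux).
by right; split=> // y /IA /AU.
Qed.

Lemma jac_submod : submod jac.
Proof.
split=> [m [[m0 _] _ _] //|a x y jx jy m mm].
by have [[_ ml] _ _] := mm; apply: ml; [exact: jx | exact: jy].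
Qed.

Lemma jac_mul a x : jac x -> jac (a * x).
Proof.
by move=> jx; have [j0 jl] := jac_submod; rewrite -[_ * _]addr0; exact: jl.
Qed.

Lemma jac_inv x : jac x -> exists u : L, u * (1 - x) = 1.
Proof.
move=> jx; apply: contrapT => nu.
have [|m [mm Im]] := exists_maxideal (im_submod (mulby (1 - x : L^o))).
  by move=> [u u1]; apply: nu; exists u.
have [[m0 ml] m1 _] := mm; apply: m1.
have -> : 1 = 1 *: (1 - x) + x :> L^o by rewrite scale1r subrK.
by apply: ml; [apply: Im; exists 1; exact: scale1r | exact: jx].
Qed.

(* jac_kill n x says that the n-th power of the radical annihilates x. *)
Fixpoint jac_kill M (n : nat) (x : M) : Prop :=
  if n is n'.+1 then forall j : L, jac j -> jac_kill n' (j *: x) else x = 0.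

Lemma jac_kill0 M n : @jac_kill M n 0.
Proof. by elim: n => //= n IH j _; rewrite scaler0. Qed.

Lemma jac_killS M n (x : M) : jac_kill n x -> jac_kill n.+1 x.
Proof.
elim: n x => [|n IH] x; first by move=> -> j _; exact: scaler0.
by move=> nx j jj; apply: IH; exact: nx.
Qed.

Lemma jac_killD M n (x y : M) : jac_kill n x -> jac_kill n y -> jac_kill n (x + y).
Proof.
elim: n x y => [|n IH] x y /= => [-> ->|nx ny j jj]; first exact: addr0.
by rewrite scalerDr; apply: IH; [exact: nx | exact: ny].
Qed.

Lemma jac_kill_lin M N (f : {linear M -> N}) n x : jac_kill n x -> jac_kill n (f x).
Proof.
elim: n x => [|n IH] x /= => [->|nx j jj]; first exact: linear0.
by rewrite -linearZ; apply: IH; exact: nx.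
Qed.

Lemma jac_kill_inj M N (f : {linear M -> N}) n x :
  injective f -> jac_kill n (f x) -> jac_kill n x.
Proof.
move=> fi; elim: n x => [|n IH] x /=; first exact: inj_eq0.
by move=> nx j jj; apply: IH; rewrite linearZ; exact: nx.
Qed.

(** The classical argument for artinian rings, with powers of the radical J replaced by the left
    ideals [ann n] annihilating everything that J^n kills; products of ideals are thereby
    avoided. *)
Lemma jac_nilpotent : exists l, forall M (x : M), jac_kill l x.
Proof.
pose ann n (u : L^o) := forall M (x : M), jac_kill n x -> (u : L) *: x = 0.
have annS n (u j : L) : ann n u -> jac j -> ann n.+1 (u * j).
  by move=> nu jj M x nx; rewrite -scalerA; apply: nu; exact: nx.
have annK n M (x : M) : (forall u, ann n u -> (u : L) *: x = 0) -> jac_kill n x.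
  elim: n x => [|n IH] x nx /=.
    by rewrite -[LHS]scale1r; apply: nx => N y ->; exact: scaler0.
  by move=> j jj; apply: IH => u nu; rewrite scalerA; apply: nx; exact: annS.
have [||_ [[l ->] lmin]] := fg_dcc (@fg_regular L) (F := fun U => exists n, U = ann n).
- by exists (ann 0), 0%N.
- move=> _ [n ->]; split=> [M x _|a u v nu nv M x nx]; first exact: scale0r.
  by rewrite scalerDl (nv _ _ nx) -[a *: u]/(a * u) -scalerA (nu _ _ nx) scaler0 addr0.
(* The descending chain [ann n] is stationary from [l] on, and by [annK] it detects [jac_kill n]. *)
have stab M (x : M) : jac_kill l.+1 x -> jac_kill l x.
  move=> lx; apply: annK => u lu.
  apply: (lmin (ann l.+1) (ex_intro _ _ erefl) _ u lu) => //.
  by move=> v lv N y /jac_killS; exact: lv.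
exists l => M x; rewrite -[x]scale1r.
apply: (jac_kill_lin (mulby x) (x := 1)); apply: contrapT => n1.
have [||A [[[A0 Al] [a [Aa na]]] Amin]] := fg_dcc (@fg_regular L)
  (F := fun A => submod A /\ exists a, A a /\ ~ jac_kill l a).
- by exists (fun=> True); split; [split | exists 1].
- by move=> U [].
(* J a lies in [A] and, by [stab], still contains an element not killed by J^l. Minimality puts [a]
   in J a, and left invertibility of [1 - j] gives [a = 0]. *)
have [|||j [jj ja]] := Amin (fun b => exists j : L, jac j /\ j * a = b) _ _ a.
- split; last first.
    have /existsNP[j /not_implyP[jj nj]] : ~ jac_kill l.+1 a by move/stab.
    by exists (j * a); split=> //; exists j.
  split; first by exists 0; rewrite mul0r; split=> //; case: jac_submod.
  move=> b _ _ [j [jj <-]] [j' [jj' <-]]; exists (b * j + j').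
  split; first by case: jac_submod => _; apply.
  by rewrite mulrDl -mulrA.
- move=> _ [j [_ <-]]; rewrite -[j * a]/(j *: (a : L^o)) -[_ *: _]addr0; exact: Al.
- by [].
apply: na; suff -> : a = 0 by exact: jac_kill0.
have [u u1] := jac_inv jj.
by rewrite -[a]mul1r -u1 -mulrA mulrBl mul1r ja subrr mulr0.
Qed.

(** The submodule J M, defined impredicatively to avoid handling finite sums of products. *)
Definition jacM M (x : M) : Prop := forall U : M -> Prop,
  U 0 -> (forall y z, U y -> U z -> U (y + z)) ->
  (forall (j : L) y, jac j -> U (j *: y)) -> U x.

Lemma jacM_submod M : submod (@jacM M).
Proof.
split=> [U //|a x y jx jy U U0 UD Uj]; apply: (UD); last exact: (jy U).
apply: (jx (fun z => U (a *: z))) => [|z t Uz Ut|j z jj]; first by rewrite scaler0.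
  by rewrite scalerDr; exact: UD.
by rewrite scalerA; apply: Uj; exact: jac_mul.
Qed.

Lemma jacM_lin M N (f : {linear M -> N}) x : jacM x -> jacM (f x).
Proof.
move=> jx U U0 UD Uj; apply: (jx (U \o f)) => [|y z Uy Uz|j y jj] /=.
- by rewrite linear0.
- by rewrite linearD; exact: UD.
- by rewrite linearZ; exact: Uj.
Qed.

Lemma jac_kill_jacM M n : (forall x : M, jac_kill n.+1 x) ->
  forall x : M, jacM x -> jac_kill n x.
Proof.
move=> Mn x jx; apply: (jx (@jac_kill M n)); first exact: jac_kill0.
  by move=> y z; exact: jac_killD.
by move=> j y jj; exact: Mn.
Qed.

(** Nilpotency takes the place of finite generation: M = J M = J^2 M = ... = 0. *)
Lemma nakayama M : (forall x : M, jacM x) -> forall x : M, x = 0.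
Proof.
move=> MJ; have [l lM] := jac_nilpotent; have := lM M; elim: l {lM} => // l IH Ml.
by apply: IH => x; apply: jac_kill_jacM.
Qed.

Definition simple_elt V (v : V) : Prop :=
  v != 0 /\ forall a : L, a *: v != 0 -> exists b : L, b *: (a *: v) = v.

Lemma maxideal_simple V (v : V) m :
  maxideal m -> (forall c : L, m c -> c *: v = 0) -> v != 0 -> simple_elt v.
Proof.
move=> [[m0 ml] m1 mmax] mv v0; split=> // a av0.
apply: contrapT => nb.
have : m a; last by move=> /mv E; rewrite E eqxx in av0.
apply: (mmax (fun x => exists b c : L, m c /\ c + b * a = x)).
- split; first by exists 0, 0; rewrite mul0r addr0.
  move=> d _ _ [b [c [mc <-]]] [b' [c' [mc' <-]]].
  exists (d * b + b'), (d * c + c'); split; first exact: ml.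
  by rewrite -[_ *: _]/(d * _) mulrDl mulrDr addrACA mulrA.
- by move=> x mx; exists 0, x; rewrite mul0r addr0.
- move=> [b [c [mc cb]]]; apply: nb; exists b.
  by rewrite -[RHS]scale1r -cb scalerDl (mv c mc) add0r scalerA.
- by exists 1, 0; rewrite mul1r add0r.
Qed.

Fixpoint interI (s : seq (L^o -> Prop)) (x : L^o) : Prop :=
  if s is m :: s' then m x /\ interI s' x else True.
Fixpoint allmax (s : seq (L^o -> Prop)) : Prop :=
  if s is m :: s' then maxideal m /\ allmax s' else True.

Lemma interI_submod s : allmax s -> submod (interI s).
Proof.
elim: s => [|m s IH] //= [[[m0 ml] _ _] /IH[I0 Il]].
by split=> // a x y [mx Ix] [my Iy]; split; [exact: ml | exact: Il].
Qed.

(** A minimal finite intersection of maximal left ideals cannot shrink further, so it lies in every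
    maximal left ideal. *)
Lemma jac_interI : exists s, allmax s /\ forall x, interI s x -> jac x.
Proof.
have [||_ [[s [sm ->]] smin]] := fg_dcc (@fg_regular L)
  (F := fun I => exists s, allmax s /\ I = interI s).
- by exists (interI [::]), [::].
- by move=> _ [s [/interI_submod ? ->]].
exists s; split=> // x sx m mm.
have [||] // := smin (interI (m :: s)) _ _ x sx; first by exists (m :: s).
by move=> y [].
Qed.

(** Induction on the number of maximal ideals whose intersection kills [x]. If I, the intersection
    over the tail, is not inside [m], write 1 = a + b with a in I and b in [m]. Then [m] kills a x,
    which is therefore zero or generates a simple module, and I kills b x, to which induction
    applies. *)
Lemma semisimple_generated V : (forall (j : L) (x : V), jac j -> j *: x = 0) ->
  forall (U : V -> Prop), submod U -> (forall v, simple_elt v -> U v) -> forall x, U x.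
Proof.
move=> JV U [U0 Ul] Us x; have [s [sm sJ]] := jac_interI.
have {sJ JV} : forall a : L, interI s a -> a *: x = 0.
  by move=> a /sJ; exact: JV.
elim: s sm x => [_ x sx|m s IH /= [mm sm] x sx].
  by rewrite -[x]scale1r sx.
have [all_m|/existsNP[a0 /not_implyP[sa0 ma0]]] :=
    pselect (forall a, interI s a -> m a).
  by apply: IH => // a sa; apply: sx; split=> //; exact: all_m.
have [s0 sl] := interI_submod sm; have [[m0 ml] m1 mmax] := mm.
have mZ a b : m b -> m (a * b) by move=> mb; rewrite -[_ * _]addr0; exact: ml.
have sZ a b : interI s b -> interI s (a * b).
  by move=> sb; rewrite -[_ * _]addr0; exact: sl.
have mB a b : m a -> m b -> m (a - b).
  by move=> ma mb; rewrite addrC -scaleN1r; exact: ml.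
have sB a b : interI s a -> interI s b -> interI s (a - b).
  by move=> sa sb; rewrite addrC -scaleN1r; exact: sl.
have [a [b [sa mb ab]]] : exists a b : L, [/\ interI s a, m b & a + b = 1].
  apply: contrapT => nab; apply: ma0.
  apply: (mmax (fun x => exists a b : L, [/\ interI s a, m b & a + b = x])).
  - split; first by exists 0, 0; rewrite addr0.
    move=> d _ _ [a [b [sa mb <-]]] [a' [b' [sa' mb' <-]]].
    exists (d * a + a'), (d * b + b'); split; [exact: sl | exact: ml |].
    by rewrite -[_ *: _]/(d * _) mulrDr addrACA.
  - by move=> y my; exists 0, y; rewrite add0r.
  - exact: nab.
  - by exists a0, 0; rewrite addr0.
have ba : b = 1 - a by rewrite -ab addrAC subrr add0r.
have ab' : a = 1 - b by rewrite -ab addrK.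
rewrite -[x]scale1r -ab scalerDl -[a *: x]scale1r; apply: Ul.
  have [->//|ax0] := eqVneq (a *: x) 0.
  apply: Us; apply: (maxideal_simple mm) => // c mc; rewrite scalerA; apply: sx.
  split; last exact: sZ.
  by rewrite ab' mulrBr mulr1; apply: mB => //; exact: mZ.
apply: IH => // i si; rewrite scalerA; apply: sx; split; first exact: mZ.
by rewrite ba mulrBr mulr1; apply: sB => //; exact: sZ.
Qed.

End ArtinianRing.

(** * Semisimple modules and filtrations *)

Section Semisimple.
Variable L : pzRingType.
Implicit Types D M N P Q R V W X Y Z : lmodType L.

Hypothesis fg_dcc : forall M, fin_gen M -> submod_dcc M.
Variables (n : nat) (S : 'I_n -> lmodType L).
Hypothesis Srep : simple_representatives S.

Lemma simple_generated M : simple_lmod M ->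
  forall x : M, x != 0 -> forall y, exists a : L, a *: x = y.
Proof.
move=> [_ Msub] x x0 y.
have [U0 Ul] := im_submod (mulby x).
have [|U1|U1] := Msub (fun y => `[< exists a, mulby x a = y >]).
- split=> [|a u v /asboolP Uu /asboolP Uv]; apply/asboolP; [exact: U0 | exact: Ul].
- have /= := U1 x; rewrite !unfold_in /= (negbTE x0) => /asboolPn[].
  by exists 1; exact: scale1r.
- by have /= := U1 y; rewrite !unfold_in /= => /asboolP.
Qed.

Lemma simple_elt_rep V (v : V) : simple_elt v ->
  exists j (t : {linear S j -> V}),
    [/\ injective t, forall y, exists a : L, t y = a *: v & exists y, t y = v].
Proof.
move=> [v0 vs]; have [W [k [ki kP]]] := exists_sub (im_submod (mulby v)).
have kW w : exists a : L, k w = a *: v.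
  by have /kP[a <-] : exists s, k s = k w by [exists w]; exists a.
have /kP[w wv] : exists a, mulby v a = v by exists 1; exact: scale1r.
have Ws : simple_lmod W.
  split; first by exists w; apply: contraNneq v0 => w0; rewrite -wv w0 linear0.
  move=> U [U0 Ul].
  have [[u [Uu u0]]|none] := pselect (exists u, u \in U /\ u != 0); [right|left].
    move=> y; rewrite [RHS]unfold_in.
    have [a ku] := kW u; have av0 : a *: v != 0.
      by apply: contraNneq u0 => av; apply/eqP/(inj_eq0 ki); rewrite ku.
    have [b ba] := vs a av0; have [c ky] := kW y.
    have -> : y = (c * b) *: u + 0.
      by apply: ki; rewrite addr0 linearZ /= ku ky -scalerA ba.
    exact: Ul.
  move=> y; rewrite [RHS]unfold_in /=; apply/idP/eqP => [Uy|-> //].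
  by apply: contrapT => /eqP y0; apply: none; exists y.
have [_ _ /(_ W Ws) [j [f [g fg gf]]]] := Srep.
have [t tP] : exists t : {linear S j -> W}, forall x, t (f x) = lid W x.
  apply: factor_surj => [y|x fx]; first by exists (g y).
  by rewrite -[x]fg fx -(linear0 f) fg.
have tg y : t y = g y by rewrite -[y in LHS]gf tP.
exists j, (k \o t); split=> [x y /ki|y|]; last by exists (f w); rewrite /= tP.
  by rewrite !tg => /(can_inj gf).
exact: kW.
Qed.

Lemma semisimple_dsum V : (forall (j : L) (x : V), jac j -> j *: x = 0) ->
  exists (I : choiceType) (sigma : I -> 'I_n) D
    (inj : forall i, {linear S (sigma i) -> D})
    (pr : forall i, {linear D -> S (sigma i)}) (g : {linear D -> V}),
    [/\ is_dsum inj pr, injective g & surj g].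
Proof.
move=> JV.
(* Independence concerns the multiples [c v *: v], since the coefficients are determined only modulo
   annihilators. *)
pose indep (B : set V) := (forall v, B v -> simple_elt v) /\
  forall s : seq V, uniq s -> (forall v, v \in s -> B v) ->
    forall c : V -> L, \sum_(v <- s) c v *: v = 0 ->
    forall v, v \in s -> c v *: v = 0.
have [|B [[Bs Bi] Bmax]] := @Zorn_bigcup V indep.
  move=> F FP Ftot; split=> [v [B FB Bv]|s us sF]; first by have [+ _] := FP B FB; exact.
  case: s us sF => [//|v0 s us sF].
  have [B FB sB] : exists2 B, F B & forall v, v \in v0 :: s -> B v.
    have [B0 FB0 _] := sF v0 (mem_head v0 s).
    elim: {us} (v0 :: s) sF => [|v t IH] tF; first by exists B0.
    have [|B FB tB] := IH; first by move=> u ut; apply: tF; rewrite inE ut orbT.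
    have [C FC Cv] := tF v (mem_head v t).
    case: (Ftot _ _ FB FC) => BC; [exists C | exists B] => // u;
      rewrite inE => /predU1P[->|/tB Bu] //; exact: BC.
  by have [_ Bi] := FP B FB; exact: Bi.
pose spanB x := exists s : seq V, (forall v, v \in s -> B v) /\ lspan id s x.
have sB_sub : submod spanB.
  split; first by exists [::].
  move=> a x y [s [sB sx]] [t [tB ty]]; exists (s ++ t); split=> [v|].
    by rewrite mem_cat => /orP[/sB|/tB].
  have [_ Ul] := lspan_submod (s ++ t).
  apply: Ul; [apply: lspan_sub sx | apply: lspan_sub ty] => v vs;
    by rewrite mem_cat vs ?orbT.
have [spanB0 spanBl] := sB_sub.
have spanBZ a x : spanB x -> spanB (a *: x).
  by move=> sx; rewrite -[_ *: _]addr0; exact: spanBl.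
have Bspan v : B v -> spanB v.
  move=> Bv; exists [:: v]; split=> [u|]; first by rewrite inE => /eqP ->.
  by apply: lspan_mem; rewrite mem_head.
have spanB_all : forall x, spanB x.
  apply: (semisimple_generated fg_dcc JV) => // v vs; apply: contrapT => nv.
  apply: (Bmax (fun u => B u \/ u = v)).
    split=> [u Bu|/(_ v (or_intror erefl)) Bv]; first by left.
    by apply: nv; exact: Bspan.
  split=> [u [/Bs|->] //|s us sB c sc].
  have [vs'|vs'] := boolP (v \in s); last first.
    apply: (Bi s us _ c sc) => u u_s; case: (sB u u_s) => // uv.
    by rewrite -uv u_s in vs'.
  have sc' : c v *: v + \sum_(u <- rem v s) c u *: u = 0.
    by rewrite -[RHS]sc (perm_big _ (perm_to_rem vs')) big_cons.
  have remB u : u \in rem v s -> B u.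
    by rewrite mem_rem_uniq // inE => /andP[/eqP uv /sB[]].
  (* A nonzero multiple of the simple element [v] generates [v] again, so a relation involving it
     would put [v] in the span of [B]. *)
  have cv0 : c v *: v = 0.
    apply: contrapT => /eqP cv; case: vs => _ /(_ _ cv) [b bv]; apply: nv.
    rewrite -bv; apply: (spanBZ).
    have -> : c v *: v = (-1) *: \sum_(u <- rem v s) c u *: u + 0.
      by rewrite addr0 scaleN1r; apply/eqP; rewrite -addr_eq0 sc'.
    apply: (spanBl) => //; rewrite big_seq.
    elim/big_ind: _ => // [x y sx sy|u /remB /Bspan]; last exact: spanBZ.
    by rewrite -[x]scale1r; exact: spanBl.
  move=> u u_s; have [->//|uv] := eqVneq u v.
  apply: (Bi (rem v s)) => //; first exact: rem_uniq.
    by move: sc'; rewrite cv0 add0r.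
  by rewrite mem_rem_uniq // inE uv.
pose I : choiceType := {v : V | `[< B v >]}.
have Is (i : I) : simple_elt (val i) by apply: Bs; exact/asboolP/(valP i).
pose sigma (i : I) := sval (cid (simple_elt_rep (Is i))).
have sP (i : I) := svalP (cid (simple_elt_rep (Is i))).
pose t (i : I) := sval (cid (sP i)).
have tP (i : I) : [/\ injective (t i), forall y, exists a : L, t i y = a *: val i
  & exists y, t i y = val i] := svalP (cid (sP i)).
have [D [inj [pr dD]]] := exists_dsum (fun i : I => S (sigma i)).
have [g gP] := dsum_lift dD t.
exists I, sigma, D, inj, pr, g; split=> //.
- apply: lin_inj => d gd; apply: (dsum_eq0 dD) => i.
  have [F dF] := dsum_supp dD d.
  have [iF|] := boolP (i \in undup F); last by rewrite mem_undup => /dF.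
  have ex (k : I) : exists a : L, t k (pr k d) = a *: val k.
    by have [_ tk _] := tP k; exact: tk.
  have [a aP] := choice ex.
  pose c (v : V) : L := if insub v is Some k then a k else 0.
  have cP k : c (val k) = a k by rewrite /c valK.
  have [ti _ _] := tP i; apply: (inj_eq0 ti); rewrite aP -cP.
  apply: (Bi [seq val k | k <- undup F]).
  + by rewrite map_inj_uniq ?undup_uniq //; exact: val_inj.
  + by move=> _ /mapP[k _ ->]; exact/asboolP/(valP k).
  + rewrite big_map -[RHS]gd [in RHS](dsum_sumE dD (undup_uniq F) (x := d)).
      rewrite linear_sum; apply: eq_bigr => k _.
      by rewrite cP gP -aP.
    by move=> k; rewrite mem_undup; exact: dF.
  + exact: map_f.
- move=> x; have [s [sB sx]] := spanB_all x.
  apply: (lspan_ind (im_submod g) _ sx) => v /sB Bv.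
  have [_ _ [y ty]] := tP (exist _ v (asboolT Bv)).
  by exists (inj _ y); rewrite gP.
Qed.

Lemma simple_fg M : simple_lmod M -> fin_gen M.
Proof.
move=> Ms; have [[x x0] _] := Ms; apply/fin_genP; exists [:: x] => y.
have [a <-] := simple_generated Ms x0 y.
by exists a, 0; rewrite addr0.
Qed.

(** Discarding the components in [F] gives submodules that shrink strictly whenever [F] gains a new
    index, as no summand is zero. A minimal one therefore has [F] equal to the whole index set. *)
Lemma semisimple_fg V : (forall (j : L) (x : V), jac j -> j *: x = 0) ->
  submod_dcc V -> fin_gen V.
Proof.
move=> JV Vdcc; have [I [sigma [D [inj [pr [g [dD gi gs]]]]]]] := semisimple_dsum JV.
pose U (F : seq I) v := exists d, g d = v /\ forall i, i \in F -> pr i d = 0.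
have [||_ [[F ->] Fmin]] := Vdcc (fun J => exists F, J = U F).
- by exists (U [::]), [::].
- move=> _ [F ->]; split; first by exists 0; rewrite linear0; split=> // i _; exact: linear0.
  move=> a _ _ [d [<- dF]] [e [<- eF]]; exists (a *: d + e); rewrite linearP.
  by split=> // i iF; rewrite linearP dF // eF // scaler0 addr0.
have Ff i : i \in F.
  apply: contrapT => /negP iF; have [[s s0] _] : simple_lmod (S (sigma i)).
    by have [] := Srep.
  have [||d [/gi -> dF]] := Fmin (U (i :: F)) (ex_intro _ _ erefl) _ (g (inj i s)).
  - by move=> v [d [<- dF]]; exists d; split=> // k kF; apply: dF; rewrite inE kF orbT.
  - exists (inj i s); split=> // k kF; apply: (dsum_pr0 dD).
    by apply: contraNneq iF => ->.
  - by move: s0; rewrite -[s](dsum_prK dD) dF ?mem_head ?eqxx.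
have Sf i : fin_gen (S (sigma i)) by apply: simple_fg; have [] := Srep.
have [A [j [Af ji jP]]] := dsum_partial dD (@fg_trivial L) (@fg_ext L) Sf F.
apply: (fg_surj (p := g \o j)) Af => x; have [d <-] := gs x.
have /jP[a <-] : forall i, i \notin F -> pr i d = 0 by move=> i; rewrite Ff.
by exists a.
Qed.

(** Hopkins-Levitzki: [N] inherits the descending chain condition, so the semisimple N / J N is
    finitely generated, and lifts of its generators generate [N] by Nakayama. *)
Lemma fg_noetherian M N (i : {linear N -> M}) :
  injective i -> fin_gen M -> fin_gen N.
Proof.
move=> ii Mf; have Ndcc := submod_dcc_inj ii (fg_dcc Mf).
have [Q [p [ps pk]]] := exists_quo (@jacM_submod L N).
have /fin_genP[w wP] : fin_gen Q.
  apply: semisimple_fg (submod_dcc_surj ps Ndcc) => j y jj.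
  have [x <-] := ps y; rewrite -linearZ; apply/pk => U _ _; exact.
have [v vw] := surj_map w ps; apply/fin_genP; exists v.
have [R [q [qs qk]]] := exists_quo (lspan_submod v).
suff R0 : forall r : R, r = 0 by move=> x; apply/qk; exact: R0.
apply: (nakayama fg_dcc) => r; have [x <-] := qs r.
have [y [vy px]] : exists y, lspan id v y /\ p y = p x.
  apply: (lspan_ind (U := fun z => exists y, lspan id v y /\ p y = z)) (wP (p x)).
    split; first by exists 0; split; [case: (lspan_submod v) | exact: linear0].
    move=> a _ _ [y [vy <-]] [z [vz <-]]; exists (a *: y + z).
    by split; [case: (lspan_submod v) => _; apply | rewrite linearP].
  by rewrite -vw => _ /mapP[s sv ->]; exists s; split=> //; exact: lspan_mem.
have -> : q x = q (x - y).
  by rewrite linearB /=; move/qk: vy => ->; rewrite subr0.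
by apply: jacM_lin; apply/pk; rewrite linearB /= px subrr.
Qed.

Fixpoint semisimple_length (l : nat) X : Prop :=
  if l is l'.+1 then
    exists X' (i : {linear X' -> X}) (I : choiceType) (sigma : I -> 'I_n) D
      (inj : forall i, {linear S (sigma i) -> D})
      (pr : forall i, {linear D -> S (sigma i)}) (p : {linear X -> D}),
      [/\ is_dsum inj pr, ses i p & semisimple_length l' X']
  else forall x : X, x = 0.

Lemma jac_kill_length l X :
  (forall x : X, jac_kill l x) -> semisimple_length l X.
Proof.
elim: l X => [|l IH] X Xl //=.
have [Q [q [qs qk]]] := exists_quo (@jacM_submod L X).
have [|I [sigma [D [inj [pr [g [dD gi gs]]]]]]] := @semisimple_dsum Q.
  move=> j y jj; have [x <-] := qs y; rewrite -linearZ; apply/qk => U _ _; exact.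
have [p pP] : exists p : {linear X -> D}, forall x, g (p x) = q x.
  by apply: factor_inj => // x; exact: gs.
have [X' [i [ii iP]]] := exists_sub (@jacM_submod L X).
exists X', i, I, sigma, D, inj, pr, p; split=> //.
  split=> // [d|x]; first by have [x xd] := qs (g d); exists x; apply: gi; rewrite pP.
  rewrite -iP -qk -pP; split=> [->|]; [exact: linear0 | exact: inj_eq0].
apply: IH => x; apply: (jac_kill_inj ii); apply: jac_kill_jacM => //.
by apply/iP; exists x.
Qed.

Lemma exists_semisimple_length : exists l, forall X, semisimple_length l X.
Proof.
have [l lP] := jac_nilpotent fg_dcc; exists l => X; apply: jac_kill_length.
exact: lP.
Qed.

End Semisimple.

(** * Approximations *)

Section Approximations.
Variable L : pzRingType.
Implicit Types A B C D E G H K M N P Q R U V W X Y Z : lmodType L.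

Lemma pushout_univ A B Z C G X (i : {linear A -> B}) (p : {linear B -> Z})
    (f : {linear A -> C}) (v : {linear C -> G}) (r : {linear G -> Z})
    (u : {linear B -> G}) (a : {linear B -> X}) (b : {linear C -> X}) :
    ses i p -> ses v r -> (forall x, r (u x) = p x) ->
    (forall x, u (i x) = v (f x)) -> (forall g, exists x y, g = u x + v y) ->
    (forall x, a (i x) = b (f x)) ->
  exists h : {linear G -> X}, (forall x, h (u x) = a x) /\ forall y, h (v y) = b y.
Proof.
move=> ip vr ru uv gen ab; have [_ _ e] := ip; have [vi _ _] := vr.
have [h hP] : exists h : {linear G -> X}, forall z, h (copair u v z) = copair a b z.
  apply: factor_surj => [g|[x y] /= xy].
    by have [x [y ->]] := gen g; exists (x, y).
  have /e [t tx] : p x = 0.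
    by have := congr1 r xy; rewrite linearD ru (ses0 vr) addr0 linear0.
  have : v (f t + y) = 0 by rewrite linearD -uv tx.
  by move=> /(inj_eq0 vi) fty; rewrite -tx ab -linearD fty linear0.
exists h; split=> [x|y].
  by have := hP (x, 0); rewrite /= !linear0 !addr0.
by have := hP (0, y); rewrite /= !linear0 !add0r.
Qed.

Lemma linear_inverse M N (f : {linear M -> N}) : injective f -> surj f ->
  exists g : {linear N -> M}, (forall y, f (g y) = y) /\ forall x, g (f x) = x.
Proof.
move=> fi fs; have [g gP] : exists g : {linear N -> M}, forall y, f (g y) = lid N y.
  exact: factor_inj.
by exists g; split=> // x; apply: fi; rewrite gP.
Qed.

Hypothesis fg_dcc : forall M, fin_gen M -> submod_dcc M.
Hypothesis noetherian : forall M N (i : {linear N -> M}),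
  injective i -> fin_gen M -> fin_gen N.

Lemma hopfian M (f : {linear M -> M}) : fin_gen M -> surj f -> injective f.
Proof.
move=> Mf fs; pose fn := fix fn n : {linear M -> M} :=
  if n is n'.+1 then fn n' \o f else lid M.
have fnS n x : fn n (f x) = fn n.+1 x by [].
have fnC n x : fn n.+1 x = f (fn n x).
  by elim: n x => [|n IH] x //; rewrite -fnS IH.
have fn_step n x : fn n x = 0 -> fn n.+1 x = 0.
  by move=> nx; rewrite fnC nx linear0.
have fn_le n m x : (n <= m)%N -> fn n x = 0 -> fn m x = 0.
  by move=> /subnK <- nx; elim: (m - n)%N => // k IH; exact: fn_step.
have fn_surj n : surj (fn n).
  elim: n => [|n IH] y; first by exists y.
  by have [z zy] := IH y; have [x xz] := fs z; exists x; rewrite -fnS xz.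
have ker_sub : submod (fun x => exists n, fn n x = 0).
  split; first by exists 0%N; rewrite linear0.
  move=> a x y [n nx] [m my]; exists (maxn n m).
  by rewrite linearP (fn_le n) ?leq_maxl // (fn_le m) ?leq_maxr // scaler0 addr0.
have [U [i [ii iP]]] := exists_sub ker_sub.
have /fin_genP [w wP] := noetherian ii Mf.
have [n nP] : exists n, forall s, s \in w -> fn n (i s) = 0.
  elim: {wP} w => [|s w [n nP]]; first by exists 0%N.
  have /iP [m ms] : exists t, i t = i s by exists s.
  exists (maxn n m) => t; rewrite inE => /predU1P[->|/nP nt].
    exact: fn_le (leq_maxr _ _) ms.
  exact: fn_le (leq_maxl _ _) nt.
(* The kernels of the powers of [f] are all contained in that of [fn n]. Writing [x] as [fn n y],
   the element [y] is killed by [fn n.+1], hence already by [fn n]. *)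
apply: lin_inj => x fx; have [y yx] := fn_surj n x; rewrite -yx.
have /iP [z <-] : exists m, fn m y = 0.
  by exists n.+1; rewrite fnC yx.
apply: (lspan_ind (ker_submod (fn n \o i)) nP (wP z)).
Qed.

(* A summand of C on which f is right minimal is obtained from an endomorphism
   e over f whose image is minimal; the conclusion is Wakamatsu's lemma. *)
Lemma minimal_approximation X C (f : {linear C -> X}) d :
    Pfin C -> pdle d C ->
    (forall B (g : {linear B -> X}), Pfin B -> exists h : {linear B -> C},
      forall x, f (h x) = g x) ->
  exists K A (i : {linear K -> A}) (p : {linear A -> X}),
    [/\ ses i p, Pfin A, pdle d A, fin_gen K & forall B, Pfin B -> ext_vanish B K].
Proof.
move=> CP Cd fappr; have [Cf _] := CP.
have [||_ [[e [fe ->]] emin]] := fg_dcc Cf (F := fun J => exists e : {linear C -> C},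
    (forall x, f (e x) = f x) /\ J = fun y => exists x, e x = y).
- by exists (fun y => exists x, lid C x = y), (lid C).
- by move=> _ [e [_ ->]]; exact: im_submod.
have {}emin (e' : {linear C -> C}) : (forall x, f (e' x) = f x) ->
    (forall x, exists y, e y = e' x) -> forall x, exists y, e' y = e x.
  move=> fe' e'e x; apply: (emin (fun y => exists x, e' x = y)); last by exists x.
    by exists e'.
  by move=> _ [z <-]; exact: e'e.
have [A [q [v [qs vi vq]]]] := image_factor e.
have Af : fin_gen A := fg_surj qs Cf.
(* Minimality makes the image of [e \o e] equal to that of [e], so [e] induces a surjection of its
   image [A] onto itself; this is bijective by [hopfian] and makes [A] a retract of [C]. *)
have qv_surj : surj (q \o v).
  move=> a; have [c ca] := qs a.
  have [x|x|y yc] := emin (e \o e) _ _ c; first by rewrite /= !fe.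
    by exists (e x).
  by exists (q y); apply: vi; rewrite /= vq vq -[e (e y)]/((e \o e) y) yc -ca vq.
have [t [tl tr]] := linear_inverse (hopfian Af qv_surj) qv_surj.
have AC : retract A C by exists v, (t \o q) => a; exact: tr.
pose p : {linear A -> X} := f \o v.
have pq x : p (q x) = f x by rewrite /= vq fe.
have pappr B (g : {linear B -> X}) : Pfin B -> exists h : {linear B -> A},
    forall x, p (h x) = g x.
  by move=> BP; have [h hP] := fappr B g BP; exists (q \o h) => x; rewrite pq hP.
(* Right minimality of [p]: an endomorphism [h] of [A] over [X] yields the endomorphism
   [v \o h \o q] of [C] over [X], whose image cannot be smaller than [A]. *)
have pmin (h : {linear A -> A}) : (forall a, p (h a) = p a) ->
    injective h /\ surj h.
  move=> ph; suff hs : surj h by split=> //; exact: hopfian.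
  move=> a; have [c ca] := qs a.
  have [x|x|y yc] := emin (v \o h \o q) _ _ c.
  - by rewrite -[LHS]/(p (h (q x))) ph pq.
  - by have [z zx] := qs (h (q x)); exists z; rewrite -vq zx.
  - by exists (q y); apply: vi; rewrite -ca vq -yc.
have ps : surj p.
  move=> x; have [|h hP] := pappr _ (mulby x).
    by apply: Pfin_projective; [exact: projective_regular | exact: fg_regular].
  by exists (h 1); rewrite hP /= scale1r.
have AP : Pfin A := Pfin_retract AC CP.
have [K [i ip]] := ses_ker ps; have [ii _ ie] := ip.
exists K, A, i, p; split=> //.
- exact: pdle_retract AC Cd.
- exact: noetherian ii Af.
(* The pushout [G] extends [B] by [A], so it lies in [Pfin], and the map to [X] that is [p] on [A]
   and zero on [E] lifts to [w : G -> A]. Minimality makes [w \o v'] invertible; after normalization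
   by its inverse, [w] restricts to a retraction of [E] onto [K]. *)
move=> B BP E j r jr; have [G [v' [r' [u [vr ru uv gen]]]]] := pushout_ses i jr.
have GP : Pfin G := Pfin_ext vr AP BP.
have [|z [zu zv]] := pushout_univ (a := lzero E X) (b := p) jr vr ru uv gen.
  by move=> k; rewrite (ses0 ip).
have [w wP] := pappr G z GP.
have [|wi ws] := pmin (w \o v'); first by move=> a; rewrite wP zv.
have [h [hl hr]] := linear_inverse wi ws.
have ph a : p (h a) = p a by rewrite -zv -wP -[w (v' (h a))]/((w \o v') (h a)) hl.
have [rho rhoP] : exists rho : {linear E -> K}, forall x, i (rho x) = (h \o w \o u) x.
  by apply: factor_inj => // x; apply/ie; rewrite /= -[f _]/(p _) ph wP zu.
apply: (ses_retraction_section jr (r := rho)) => k.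
by apply: ii; rewrite rhoP /= uv -[w (v' _)]/((w \o v') (i k)) hr.
Qed.

(** A map from the finitely generated syzygy of [A] to [Y] meets only finitely many summands, and
    each component extends to the projective [P]. *)
Lemma ext_vanish_dsum (I : choiceType) (K : I -> lmodType L) Y
    (inj : forall i, {linear K i -> Y}) (pr : forall i, {linear Y -> K i}) A :
  is_dsum inj pr -> fin_gen A -> (forall i, ext_vanish A (K i)) -> ext_vanish A Y.
Proof.
move=> dY Af AK E i p ip; have [ii ps e] := ip.
have [P [q [Pp Pf qs]]] := fg_cover Af.
have [N [n nq]] := ses_ker qs; have [ni _ ne] := nq.
have [l lP] := projective_lift q Pp ps.
have [m mP] : exists m : {linear N -> Y}, forall x, i (m x) = (l \o n) x.
  by apply: factor_inj => // x; apply/e; rewrite /= lP (ses0 nq).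
have [F [uF mF]] := dsum_fg_supp dY m (noetherian ni Pf).
have ex k := ext_vanish_extend (pr k \o m) (AK k) nq.
pose h := lsum F (fun k => inj k \o sval (cid (ex k))).
have hP x : h (n x) = m x.
  rewrite [RHS](dsum_sumE dY uF); last by move=> k; exact: mF.
  by apply: eq_bigr => k _; rewrite /= (svalP (cid (ex k))).
have [s sP] : exists s : {linear A -> E}, forall x, s (q x) = lsub l (i \o h) x.
  by apply: factor_surj => // x /ne [y <-]; rewrite -[LHS]/(l (n y) - i (h (n y))) hP mP subrr.
exists s => a; have [x <-] := qs a; rewrite sP.
by rewrite -[lsub _ _ x]/(l x - i (h x)) linearB lP (ses0 ip) subr0.
Qed.

Lemma trivial_approximation X d : (forall x : X, x = 0) ->
  exists K A (i : {linear K -> A}) (p : {linear A -> X}),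
    [/\ ses i p, locally_Pfin A, pdle d A
      & forall W, factors_Pfin W -> ext_vanish W K].
Proof.
move=> X0; exists X, X, (lzero X X), (lid X); split.
- by apply: ses_of_iso => // x; exists x.
- move=> N g Nf; exists X, (lid X); split=> //; first exact: Pfin_trivial.
  by move=> x; exists (g x).
- exact: pdle_trivial.
- move=> W _ E i p [_ ps e].
  apply: (lin_of_rel (R := fun z x => p x = z)) => //.
    by move=> a x x' y y' <- <-; rewrite linearP.
  by move=> x /e [y <-]; rewrite (X0 y) linear0.
Qed.

(** * Approximations of arbitrary modules, glued along semisimple layers *)

Variables (n : nat) (S K0 A0 : 'I_n -> lmodType L) (d : nat).
Variables (i0 : forall j, {linear K0 j -> A0 j}) (p0 : forall j, {linear A0 j -> S j}).
Hypothesis ses0S : forall j, ses (i0 j) (p0 j).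
Hypothesis A0P : forall j, Pfin (A0 j).
Hypothesis A0d : forall j, pdle d (A0 j).
Hypothesis K0_ext : forall j B, Pfin B -> ext_vanish B (K0 j).
Hypothesis K0_dcc : forall (I : choiceType) (sigma : I -> 'I_n) Y
  (inj : forall i, {linear K0 (sigma i) -> Y}) (pr : forall i, {linear Y -> K0 (sigma i)}),
  is_dsum inj pr -> dcc_matrix_subgroups Y.

Lemma exists_syzygy A : Pfin A -> exists R P (o : {linear R -> P}) (q : {linear P -> A}),
  [/\ ses o q, projective P & Pfin R].
Proof.
move=> [Af [m Am]]; have [P [q [Pp Pf qs]]] := fg_cover Af.
have [R [o oq]] := ses_ker qs; exists R, P, o, q; split=> //; split.
  exact: (fg_ker noetherian oq).
by exists m; apply: (pdle_syzygy oq) => //; exact: pdleS.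
Qed.

(** The pullback [W] of [DA] and [X] over [D] is an extension of [DA] by [X']. Replacing [X'] by its
    approximation [A'] amounts to lifting the class of [W] along [p'], which is possible since
    Ext^2(DA, K') = Ext^1(DR, K') = 0; the lifted extension is [G]. *)
Lemma approximation_of_length l X : semisimple_length S l X ->
  exists K A (i : {linear K -> A}) (p : {linear A -> X}),
    [/\ ses i p, locally_Pfin A, pdle d A
      & forall W, factors_Pfin W -> ext_vanish W K].
Proof.
elim: l X => [|l IH] X /=; first exact: trivial_approximation.
move=> [X' [i [I [sigma [D [inj [pr [p [dD ip /IH]]]]]]]]].
move=> [K' [A' [i' [p' [ip' A'l A'd K'ext]]]]].
have [DA [jA [qA dA]]] := exists_dsum (A0 \o sigma).
have [DK [jK [qK dK]]] := exists_dsum (K0 \o sigma).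
have [f [g [fg _ _]]] := dsum_ses dK dA dD (fun k => ses0S (sigma k)).
have DKext W : factors_Pfin W -> ext_vanish W DK.
  apply: (ext_vanish_factors noetherian (K0_dcc dK)) => A AP.
  by apply: (ext_vanish_dsum dK AP.1) => k; exact: K0_ext.
have [W [j [b [a [jb ab aj Wex]]]]] := pullback_ses g ip.
have [ji bs be] := jb; have [ii ps e] := ip; have [fi gs ge] := fg.
have [ii' ps' e'] := ip'.
(* Syzygies are taken summand by summand, so that [DR] is a direct sum of modules in [Pfin], hence
   factoring, and [K'ext] applies to it. *)
have exS k := exists_syzygy (A0P (sigma k)).
pose R0 k := sval (cid (exS k)); have R0P k := svalP (cid (exS k)).
pose P0 k := sval (cid (R0P k)); have P0P k := svalP (cid (R0P k)).
pose o0 k := sval (cid (P0P k)); have o0P k := svalP (cid (P0P k)).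
pose q0 k := sval (cid (o0P k)).
have q0P k : [/\ ses (o0 k) (q0 k), projective (P0 k) & Pfin (R0 k)].
  exact: svalP (cid (o0P k)).
have [DR [jR [qR dR]]] := exists_dsum R0.
have [DP [jP [qP dP]]] := exists_dsum P0.
have [|o [q [oq _ _]]] := dsum_ses (i := o0) (p := q0) dR dP dA.
  by move=> k; have [] := q0P k.
have DPp : projective DP by apply: (projective_dsum dP) => k; have [] := q0P k.
have DRl : locally_Pfin DR by apply: (locally_dsum dR) => k; have [] := q0P k.
have [h hP] := projective_lift q DPp bs.
have [m mP] : exists m : {linear DR -> X'}, forall x, j (m x) = (h \o o) x.
  by apply: factor_inj => // x; apply/be; rewrite /= hP (ses0 oq).
have [m' m'P] := ext_vanish_lift m (K'ext DR (locally_factors DRl)) ip'.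
have [G [v [r [u [vr ru uv gen]]]]] := pushout_ses m' oq.
have [|phi [phiu phiv]] := pushout_univ (a := h) (b := j \o p') oq vr ru uv gen.
  by move=> x; rewrite /= m'P mP.
have bphi y : b (phi y) = r y.
  have [x [z ->]] := gen y; rewrite !linearD phiu phiv hP ru.
  by rewrite /= (ses0 jb) (ses0 vr).
have [_ rs re] := vr.
have phis : surj phi.
  move=> w; have [y yw] := rs (b w).
  have /be [x' xw] : b (w - phi y) = 0 by rewrite linearB bphi yw subrr.
  have [a' a'x] := ps' x'; exists (v a' + y).
  by rewrite linearD phiv /= a'x xw subrK.
have as_ : surj a.
  move=> x; have [y yx] := gs (p x); have [w [<- _]] := Wex x y (esym yx).
  by exists w.
have psi_s : surj (a \o phi).
  by move=> x; have [w <-] := as_ x; have [y <-] := phis w; exists y.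
have [K [k kpsi]] := ses_ker psi_s; have [ki _ ke] := kpsi.
exists K, G, k, (a \o phi); split=> //.
- apply: (locally_ext noetherian vr) => //.
  by apply: (locally_dsum dA) => t; exact: A0P.
- by apply: (pdle_ext vr) => //; apply: (pdle_dsum dA) => t; exact: A0d.
have [x' x'P] : exists x' : {linear K' -> K}, forall y, k (x' y) = (v \o i') y.
  apply: factor_inj => // y; apply/ke.
  by rewrite /= phiv /= (ses0 ip') !linear0.
have [c cP] : exists c : {linear K -> DK}, forall y, f (c y) = (b \o phi \o k) y.
  apply: factor_inj => // y; apply/ge.
  by rewrite /= -ab -[a (phi (k y))]/((a \o phi) (k y)) (ses0 kpsi) linear0.
(* The kernel sequence, as in the snake lemma, of the map from [A' -> G -> DA] onto
   [X' -> X -> D]. *)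
have x'c : ses x' c.
  split.
  - apply: lin_inj => y x'y; apply: (inj_eq0 ii'); have [vi _ _] := vr.
    by apply: (inj_eq0 vi); rewrite -[v _]/((v \o i') y) -x'P x'y linear0.
  - move=> z; have [|w [aw bw]] := Wex 0 (f z); first by rewrite linear0 (ses0 fg).
    have [y yw] := phis w; have /ke [t ty] : (a \o phi) y = 0 by rewrite /= yw.
    by exists t; apply: fi; rewrite cP /= ty yw.
  - move=> y; split=> [cy|[z <-]]; last first.
      by apply: (inj_eq0 fi); rewrite cP /= x'P /= phiv /= (ses0 ip') !linear0.
    have /be [t tw] : b (phi (k y)) = 0 by rewrite -[LHS](cP y) cy linear0.
    have t0 : t = 0.
      by apply: (inj_eq0 ii); rewrite -aj tw; exact: (ses0 kpsi y).
    have /re [a' a'y] : r (k y) = 0 by rewrite -bphi -tw (ses0 jb).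
    have /e' [z za] : p' a' = 0.
      by apply: (inj_eq0 ji); rewrite -[j _]/((j \o p') a') -phiv a'y -tw t0 linear0.
    by exists z; apply: ki; rewrite x'P /= za a'y.
move=> V VF; apply: (ext_vanish_extr x'c); [exact: K'ext | exact: DKext].
Qed.

Hypothesis Slength : exists l, forall X, semisimple_length S l X.

Lemma exists_approximation X :
  exists K A (i : {linear K -> A}) (p : {linear A -> X}),
    [/\ ses i p, locally_Pfin A, pdle d A
      & forall W, factors_Pfin W -> ext_vanish W K].
Proof. by have [l lP] := Slength; exact: approximation_of_length (lP X). Qed.

Lemma pdle_factors m X : pdle m X -> factors_Pfin X.
Proof.
elim: m X => [|m IH] X; first exact: factors_projective.
move=> [P [R [o [q [Pp oq /IH Rf]]]]].
have [K1 [A1 [i1 [p1 [ip1 A1l _ K1ext]]]]] := exists_approximation X.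
have [K2 [A2 [i2 [p2 [ip2 A2l _ K2ext]]]]] := exists_approximation K1.
have [ii1 ps1 e1] := ip1; have [ii2 ps2 e2] := ip2.
have [oi qs oe] := oq.
have K1K2 : ext_vanish K1 K2.
  (* Over [A1], the pullback [W] is an extension by the factoring syzygy [R], so Ext^1(W, K2) = 0.
     Over the projective [P] it splits with kernel [K1], which is therefore a retract of [W]. *)
  have [W [j [b [a [jb ab aj Wex]]]]] := pullback_ses p1 oq.
  have Wext : ext_vanish W K2.
    apply: (ext_vanish_extl jb); first exact: K2ext.
    by apply: K2ext; exact: locally_factors.
  have [_ _ be] := jb.
  have as_ : surj a.
    move=> x; have [y yx] := ps1 (q x).
    by have [w [<- _]] := Wex x y (esym yx); exists w.
  have [s sP] := projective_lift (lid P) Pp as_.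
  have [c cP] : exists c : {linear K1 -> W}, forall x, a (c x) = 0 /\ b (c x) = i1 x.
    apply: (lin_of_rel (R := fun x w => a w = 0 /\ b w = i1 x)).
    - by move=> t x x' w w' [aw bw] [aw' bw']; rewrite !linearP aw bw aw' bw' scaler0 addr0.
    - by move=> x; apply: Wex; rewrite linear0 (ses0 ip1).
    - move=> w [aw]; rewrite linear0 => /be [z zw].
      by rewrite -zw (inj_eq0 oi (x := z)) ?linear0 // -aj zw.
  have [r rP] : exists r : {linear W -> K1}, forall w, i1 (r w) = b (lsub (lid W) (s \o a) w).
    apply: (factor_inj (f := b \o lsub (lid W) (s \o a))) => // w; apply/e1.
    by rewrite /= -ab linearB /= sP subrr linear0.
  apply: (ext_vanish_retract _ Wext); exists c, r => x; apply: ii1.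
  by have [ac bc] := cP x; rewrite rP /= ac linear0 subr0.
have [s sP] := K1K2 _ _ _ ip2.
have [r [ri rs]] := ses_section_retraction ip2 sP.
have K2f : factors_Pfin K2.
  by apply: (factors_retract _ (locally_factors A2l)); exists i2, r.
(* As [A2] is the sum of [K1] and [K2], this is the sequence [K1 -> A1 -> X] with an identity of
   [K2] added. The addition turns the left term into [A2], which is [locally_Pfin] as
   [factors_coker] demands, whereas [K1] is only a retract of such a module. *)
pose f : {linear A2 -> (A1 * K2)%type} := pairl (i1 \o p2) r.
pose g : {linear (A1 * K2)%type -> X} := p1 \o @lfst L A1 K2.
apply: (factors_coker noetherian (i := f) (p := g)) => //; last first.
  exact: factors_prod (locally_factors A1l) K2f.
have gE x y : g (x, y) = p1 x by rewrite /= addr0.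
split.
- apply: lin_inj => x [] /(inj_eq0 ii1) px rx; rewrite (rs x) px rx.
  by rewrite !linear0 addr0.
- by move=> x; have [y yx] := ps1 x; exists (y, 0); rewrite gE.
- move=> [x y]; rewrite gE; split=> [/e1 [k kx]|[z [<- _]]]; last first.
    exact: (ses0 ip1).
  exists (i2 y + s k); congr (_, _) => /=.
    by rewrite (linearD p2) (ses0 ip2) add0r sP.
  have := rs (i2 y + s k); rewrite (linearD p2) (ses0 ip2) add0r sP.
  by move=> /addIr /ii2 /esym.
Qed.

Lemma pdle_approximation m X : pdle m X -> pdle d X.
Proof.
move=> /pdle_factors Xf.
have [K [A [i [p [ip _ Ad Kext]]]]] := exists_approximation X.
have [s sP] := Kext X Xf _ _ _ ip.
by apply: (pdle_retract _ Ad); exists s, p.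
Qed.

End Approximations.

(** * Finitistic dimension *)

Section Pdim.
Variable L : pzRingType.
Implicit Types M K P Q : lmodType L.

Lemma pdle_resolution M m : has_proj_resolution M m -> pdle m M.
Proof.
elim: m M => [|m IH] M [P [d [e [[Pp es e0 dd] P0]]]].
  have ei : injective e.
    apply: lin_inj => x /e0 [z <-].
    by rewrite (P0 1%N isT z) linear0.
  have [g [gl gr]] := linear_inverse ei es.
  exact: (projective_retract (s := g) (r := e) gl (Pp 0%N)).
have [K [i ie]] := ses_ker (es : surj e); have [ii _ ke] := ie.
exists (P 0%N), K, i, e; split=> //.
have [e' e'P] : exists e' : {linear P 1%N -> K}, forall x, i (e' x) = d 0%N x.
  by apply: factor_inj => // x; apply/ke/e0; exists x.
apply: IH; exists (fun j => P j.+1), (fun j => d j.+1), e'; split; last first.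
  by move=> j mj x; apply: (P0 j.+1).
split=> [j|y|x|j x]; first exact: Pp.
- have /e0 [z zy] := ses0 ie y; by exists z; apply: ii; rewrite e'P.
- rewrite -dd -e'P; split=> [->|]; [exact: linear0 | exact: inj_eq0].
- exact: dd.
Qed.

Lemma resolution_pdle M m : pdle m M -> has_proj_resolution M m.
Proof.
elim: m M => [|m IH] M.
  have [Z Z0] := exists_trivial L; move=> Mp.
  pose P j := if j is 0%N then M else Z.
  exists P, (fun j => lzero (P j.+1) (P j)), (lid M); split; last by case.
  split=> [[|j]|y|x|[|j] x] //.
  - exact: projective_trivial.
  - by exists y.
  - by split=> [x0|[z <-] //]; exists 0.
  - by split=> // _; exists 0; exact/esym/Z0.
  - by split=> // _; exists 0; exact/esym/Z0.
move=> [P0 [K [i [p [P0p ip /IH [P [d [e [[Pp es e0 dd] Pt]]]]]]]]].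
have [ii ps ke] := ip.
pose Q j := if j is j'.+1 then P j' else P0.
pose dQ j : {linear Q j.+1 -> Q j} :=
  if j is j'.+1 return {linear Q j.+1 -> Q j} then d j' else i \o e.
exists Q, dQ, p; split; last by case=> // j mj; exact: Pt.
split=> [j|//|x|j x].
- by case: j => [|j]; [exact: P0p | exact: Pp].
- rewrite ke; split=> [[a <-]|[z <-]]; last by exists (e z).
  by have [z <-] := es a; exists z.
- case: j x => [|j] x; last exact: dd.
  rewrite -[_ <-> _]/(i (e x) = 0 <-> exists z, d 0%N z = x) -e0.
  by split=> [/(inj_eq0 ii)|->] //; exact: linear0.
Qed.

Lemma pdim_pdle M m : (pdim M <= enat_fin m)%O <-> pdle m M.
Proof.
by rewrite pdim_leP; split; [exact: pdle_resolution | exact: resolution_pdle].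
Qed.

Lemma pdim_finite M : (pdim M < enat_infty)%O <-> exists m, pdle m M.
Proof.
split=> [|[m /pdim_pdle Mm]]; last exact: Order.POrderTheory.le_lt_trans Mm _.
case E : (pdim M) => [m|] // _; exists m; apply/pdim_pdle.
by rewrite E Order.POrderTheory.lexx.
Qed.

Lemma Pinf_Pfin M : Pinf M <-> Pfin M.
Proof. by rewrite /Pinf pdim_finite. Qed.

End Pdim.

(** * The common bound for all modules of finite projective dimension *)

Section Main.
Variables (L : pzRingType) (n : nat) (S C : 'I_n -> lmodType L).
Variable f : forall i : 'I_n, {linear C i -> S i}.

Lemma pdle_Findim d :
  artin_algebra L -> simple_representatives S ->
  (forall i, approximation (@Pinf L) (f i)) -> (forall i, pdle d (C i)) ->
  forall m (M : lmodType L), pdle m M -> pdle d M.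
Proof.
move=> [k [phi [kart kcentral kfin]]] Srep fappr Cd m M.
have fg_dcc (N : lmodType L) : fin_gen N -> submod_dcc N.
  by move=> Nf F; exact: (submod_min kart kfin Nf).
have noeth := fg_noetherian fg_dcc Srep.
have ex i : exists (K A : lmodType L) (j : {linear K -> A}) (p : {linear A -> S i}),
    [/\ ses j p, Pfin A, pdle d A, fin_gen K & forall B : lmodType L, Pfin B -> ext_vanish B K].
  have [CP fP] := fappr i.
  apply: (minimal_approximation fg_dcc noeth (f := f i)) => //.
    exact/Pinf_Pfin.
  move=> B g /Pinf_Pfin BP; have [h hP] := fP B g BP.
  by exists h => x; rewrite hP.
pose K i := sval (cid (ex i)); have exA i := svalP (cid (ex i)).
pose A i := sval (cid (exA i)); have exj i := svalP (cid (exA i)).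
pose j i := sval (cid (exj i)); have exp i := svalP (cid (exj i)).
pose p i := sval (cid (exp i)).
have jp i : [/\ ses (j i) (p i), Pfin (A i), pdle d (A i), fin_gen (K i)
  & forall B : lmodType L, Pfin B -> ext_vanish B (K i)] := svalP (cid (exp i)).
apply: (pdle_approximation noeth (i0 := j) (p0 := p)).
- by move=> i; have [] := jp i.
- by move=> i; have [] := jp i.
- by move=> i; have [] := jp i.
- by move=> i; have [] := jp i.
- move=> I sigma Y inj pr dY.
  apply: (dcc_matrix_dsum kart kcentral kfin (K := K) _ dY).
  by move=> i; have [] := jp i.
- exact: exists_semisimple_length.
Qed.
End Main.

Local Open Scope classical_set_scope.

Theorem corollary4p3 (L : pzRingType) (n : nat) (S C : 'I_n -> lmodType L)
    (f : forall i : 'I_n, {linear C i -> S i}%R) :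
  artin_algebra L ->
  contravariantly_finite (@Pinf L) ->
  simple_representatives S ->
  (forall i : 'I_n, approximation (@Pinf L) (f i)) ->
  Findim L = enat_sup [set pdim (C i) | i in [set: 'I_n]].
Proof.
move=> Lartin _ Srep fappr.
have [ubF lubF] := enat_sup_isLub [set v | exists M : lmodType L,
  (pdim M < enat_infty)%O /\ v = pdim M].
have [ubC lubC] := enat_sup_isLub [set pdim (C i) | i in [set: 'I_n]].
apply: Order.POrderTheory.le_anti; apply/andP; split.
  apply: lubF => _ [M [/pdim_finite [m Mm] ->]].
  (* An infinite supremum bounds everything; a finite one serves as the common bound [d] on the
     approximations. *)
  case E : (enat_sup _) => [d|]; last by case: (pdim M).
  apply/pdim_pdle; apply: (pdle_Findim Lartin Srep fappr _ Mm) => i.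
  by apply/pdim_pdle; rewrite -[enat_fin d]/(Some d) -E; apply: ubC; exists i.
apply: lubC => _ [i _ <-]; apply: ubF; exists (C i); split=> //.
by have [[]] := fappr i.
Qed.
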